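(* Let $L_n$ be the maximal size of a $D$-forest in the random decomposed Pólya tree of size $n$ described in the context, i.e. $L_n=\max_{v\in\tau} m_v$ for the random structure $(\tau,(m_v)_{v\in\tau})$ of total size $n$. Then for every fixed $0<s<1$, with probability $1-o(1)$ as $n\to\infty$, $$\bigl(1-(\log n)^{-s}\bigr)\left(\frac{-2\log n}{\log\rho}\right)\le L_n\le \bigl(1+(\log n)^{-s}\bigr)\left(\frac{-2\log n}{\log\rho}\right).$$
   Context: A Pólya tree is a rooted unlabeled tree (an isomorphism class of rooted trees); its size is its number of vertices. Let $t_n$ be the number of Pólya trees of size $n$ and $T(z)=\sum_{n\ge1}t_nz^n$, which satisfies $T(z)=z\exp\bigl(\sum_{i\ge1}T(z^i)/i\bigr)$. Let $\rho\approx 0.3383$ be the radius of convergence of $T(z)$ (one has $0<\rho<1$ and $T(\rho)=1$). Let $D(z)=\sum_{n\ge0}d_nz^n=\exp\bigl(\sum_{i\ge2}T(z^i)/i\bigr)$ (the weighted generating function of $D$-forests), and $C(z)=\sum_{n\ge1}\frac{n^{n-1}}{n!}z^n$, the solution of $C(z)=ze^{C(z)}$ (the weighted generating function of $C$-trees); then $T(z)=C(zD(z))$. Decomposition model: a structure of size $n$ is a pair $(\tau,(m_v)_{v\in\tau})$ where $\tau$ is a rooted plane (ordered) tree with $k\ge1$ vertices (the $C$-tree) and $m_v\ge0$ are integers (the size of the $D$-forest attached at $v$) with $k+\sum_v m_v=n$; its weight is $w(\tau,(m_v))=\prod_{v\in\tau}\frac{d_{m_v}}{\mathrm{outdeg}(v)!}$.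 The total weight of all structures of size $n$ equals $t_n$, and the random structure of size $n$ is chosen with probability $w/t_n$. *)

(* Defs.v *)
From HB Require Import structures.
From mathcomp Require Import all_boot all_order all_algebra finmap.
From mathcomp Require Import all_classical all_reals all_analysis.

Set Implicit Arguments.
Unset Strict Implicit.
Unset Printing Implicit Defensive.

Import Order.TTheory GRing.Theory Num.Theory.
Import numFieldNormedType.Exports.

Local Open Scope classical_set_scope.
Local Open Scope ring_scope.

(** Finite rooted plane trees: a root and the ordered list of its subtrees. *)
Inductive ptree := PNode of seq ptree.

Fixpoint ptree_encode (u : ptree) : GenTree.tree void :=
  let: PNode s := u in GenTree.Node 0 [seq ptree_encode v | v <- s].

Fixpoint ptree_decode (u : GenTree.tree void) : ptree :=
  if u is GenTree.Node _ s then PNode [seq ptree_decode v | v <- s]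
  else PNode [::].

Lemma ptree_encodeK : cancel ptree_encode ptree_decode.
Proof.
rewrite /cancel; fix IH 1 => -[s] /=; congr PNode; elim: s => //= u s IHs.
by rewrite IH IHs.
Qed.

HB.instance Definition _ := Countable.copy ptree (can_type ptree_encodeK).

Fixpoint nverts (u : ptree) : nat :=
  let: PNode s := u in (sumn [seq nverts v | v <- s]).+1.

(** The outdegrees of the vertices of a plane tree, in preorder.  Throughout,
    the vertices of [u] are identified with their preorder positions
    [0, ..., nverts u - 1]. *)
Fixpoint outdegs (u : ptree) : seq nat :=
  let: PNode s := u in size s :: flatten [seq outdegs v | v <- s].

(** Isomorphism of the underlying (unordered) rooted trees: some bijection
    between the subtrees at the roots matches isomorphic subtrees. *)
Inductive tree_iso : ptree -> ptree -> Prop :=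
  TreeIso (s1 s2 : seq ptree) (f : 'I_(size s1) -> 'I_(size s2)) :
    bijective f ->
    (forall i, tree_iso (tnth (in_tuple s1) i) (tnth (in_tuple s2) (f i))) ->
    tree_iso (PNode s1) (PNode s2).

(** A Polya tree is an isomorphism class of rooted trees, every finite rooted
    tree being represented by the plane trees obtained by ordering it. *)
Definition polya_trees (n : nat) : set (set ptree) :=
  [set [set v | tree_iso u v] | u in [set u | nverts u = n]].

Definition polya_count (n : nat) : nat := #|` fset_set (polya_trees n)|%fset.

(** The radius of convergence of [T(z)], as the supremum of the nonnegative
    reals at which the series converges. *)
Definition polya_radius (R : realType) : R :=
  sup [set r : R | 0 <= r /\
    cvgn (pseries (fun n => (polya_count n)%:R) r)].

(** Coefficient of [z^m] in the formal series [\sum_(i >= 2) T(z^i) / i]; since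
    [T] has no constant term, the indices [i > m] do not contribute. *)
Definition dlog_coef (R : realType) (m : nat) : R :=
  \sum_(2 <= i < m.+1 | (i %| m)%N) (polya_count (m %/ i))%:R / i%:R.

(** [d_n], the coefficient of [z^n] in the formal series
    [D = exp S = \sum_k S^k / k!] with [S = \sum_(i >= 2) T(z^i) / i].  As [S]
    has no constant term, [S] may be truncated after [z^n] and the exponential
    after [k = n]. *)
Definition D_coef (R : realType) (n : nat) : R :=
  (\sum_(k < n.+1)
     k`!%:R^-1 *: (\poly_(m < n.+1) dlog_coef R m) ^+ k)`_n.

(** A pair [(tau, m)], with [nth 0 m v] the size [m_v] of the D-forest attached
    at the vertex of [tau] of preorder position [v]. *)
Definition decomposition : Type := (ptree * seq nat)%type.

Definition decompositions (n : nat) : set decomposition :=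
  [set x | size x.2 = nverts x.1 /\ (nverts x.1 + sumn x.2)%N = n].

Definition weight (R : realType) (x : decomposition) : R :=
  \prod_(v < nverts x.1)
     (D_coef R (nth 0%N x.2 v) / ((nth 0%N (outdegs x.1) v)`!)%:R).

(** Probability of the event [E] for the random structure of size [n]. *)
Definition decomp_prob (R : realType) (n : nat) (E : set decomposition) : R :=
  \sum_(x \in decompositions n `&` E) (weight R x / (polya_count n)%:R).

Definition max_forest (x : decomposition) : nat :=
  \max_(v < nverts x.1) nth 0%N x.2 v.

(* Main.v *)
Require Import Defs.
From mathcomp Require Import finmap.
From mathcomp Require Import all_boot all_order all_algebra.
From mathcomp Require Import all_classical all_reals all_analysis.
From mathcomp Require Import ring lra zify.

(** Deleting copies of a subtree gives Polya's recurrence for [t_n], that is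
    [T = z D exp T] with [D = exp S], and decomposing a plane tree at its root
    gives the same equation for the weighted structures, so their total weight is
    [t_n].  Replacing [D] by its truncation [D_(<M)] in this equation gives the
    weight of the structures whose forests are all smaller than [M].

    Write [rho] for the radius of [T] and [q = sqrt rho].  Since [D(q)] is finite,
    [rho D(rho) = 1/e] and [T(rho) = 1], and [1 - T(rho (1 - u))] is of order
    [sqrt u].  Hence every window [[Y, L Y]] contains an [n] with
    [t_n rho^n >= c / Y^2], and grafting such trees together yields
    [t_n rho^n >= exp (- A (1 + log n)^2)] for all [n], which is sharp enough here.

    Upper tail: the excess [T - T_(<M)] satisfies a linear inequality whose solution
    is bounded by [D_(>=M) z T'], so that the probability of a forest of size at
    least [M] is of order [n q^M] up to a factor [exp O((log M)^2)].
    Lower tail: with [r = rho (1 + delta)] and [delta] of order [q^M] up to such a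
    factor, [r D_(<M)(r) <= 1/e] still holds, so [T_(<M)(r) <= 1] and the probability
    is at most [(1 + delta)^(- n) / (t_n rho^n)].  For [M] within a factor
    [1 + (log n)^(- s)] of the threshold both bounds tend to [0], because
    [exp ((log n)^(1 - s))] beats every power of [log n]. *)

Set Implicit Arguments.
Unset Strict Implicit.
Unset Printing Implicit Defensive.

Import Order.TTheory GRing.Theory Num.Theory.
Import numFieldNormedType.Exports.

Local Open Scope classical_set_scope.
Local Open Scope ring_scope.

(** * Counting Polya trees *)

Section PolyaRecurrence.
Local Open Scope nat_scope.

(** The threshold is governed by [q] and not by [rho] because [D] involves only [T(z^2)], [T(z^3)],
    ...: its coefficients decay at rate [q], and [n q^M = 1] at [M = - 2 log n / log rho]. The
    obstacle is the lower bound on [t_n]. The classical asymptotics [t_n ~ b rho^(- n) n^(- 3/2)]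
    rests on complex singularity analysis; here series are sequences of nonnegative coefficients,
    evaluated through partial sums at real points, and this yields a bound with the loss
    [exp (A (1 + log n)^2)]. The two tails pay for that loss differently. The upper tail compares
    [t_(n - i)] with [t_n] by joining trees of sizes [i - 1] and [n - i], so the loss is that of
    sizes near [M], only [exp (O ((log log n)^2))]. The lower tail does lose [exp (A (1 + log n)^2)]
    at size [n], but its main factor is doubly exponential in [(log n)^(1 - s)]. *)

Lemma ptree_seq_ind (P : ptree -> Prop) :
  (forall s, (forall u, u \in s -> P u) -> P (PNode s)) -> forall u, P u.
Proof.
move=> IH.
have step u s : P u -> (forall v, v \in s -> P v) ->
    forall v, v \in u :: s -> P v.
  by move=> Pu Ps v; rewrite in_cons => /predU1P[->//|/Ps].
have base v : v \in [::] -> P v by rewrite in_nil.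
exact (fix F u := let: PNode s := u in
  IH s ((fix G s : forall v, v \in s -> P v :=
           if s is v :: s' then step v s' (F v) (G s') else base) s)).
Qed.

(** * Plane forests and canonical representatives of isomorphism classes *)

Definition pforest_size (s : seq ptree) : nat := sumn [seq nverts v | v <- s].

Lemma nverts_PNode s : nverts (PNode s) = (pforest_size s).+1.
Proof. by []. Qed.

Lemma nverts_gt0 u : 0 < nverts u.
Proof. by case: u. Qed.

Lemma pforest_size_cat s1 s2 :
  pforest_size (s1 ++ s2) = pforest_size s1 + pforest_size s2.
Proof. by rewrite /pforest_size map_cat sumn_cat. Qed.

Lemma pforest_size_perm s1 s2 :
  perm_eq s1 s2 -> pforest_size s1 = pforest_size s2.
Proof. by move=> h; apply: perm_sumn; exact: perm_map. Qed.

Lemma pforest_size_nseq j u : pforest_size (nseq j u) = j * nverts u.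
Proof. by elim: j => //= j; rewrite /pforest_size /= mulSn => ->. Qed.

(** An arbitrary total order: it only serves to turn multisets of trees into sorted lists. *)
Definition ptree_le : rel ptree := fun u v => choice.pickle u <= choice.pickle v.

Lemma ptree_le_total : total ptree_le.
Proof. by move=> u v; exact: leq_total. Qed.

Lemma ptree_le_trans : transitive ptree_le.
Proof. by move=> u v w; exact: leq_trans. Qed.

Lemma ptree_le_anti : antisymmetric ptree_le.
Proof.
move=> u v; rewrite /ptree_le -eqn_leq => /eqP h.
exact: (pcan_inj (@choice.pickleK ptree)).
Qed.

Lemma perm_sort_ptree s1 s2 :
  perm_eq s1 s2 -> sort ptree_le s1 = sort ptree_le s2.
Proof.
by move/(perm_sortP ptree_le_total ptree_le_trans ptree_le_anti).
Qed.

Lemma sort_ptree_sorted s : sorted ptree_le (sort ptree_le s).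
Proof. exact: sort_sorted ptree_le_total _. Qed.

Fixpoint canon (u : ptree) : ptree :=
  let: PNode s := u in PNode (sort ptree_le [seq canon v | v <- s]).

Lemma nverts_canon u : nverts (canon u) = nverts u.
Proof.
elim/ptree_seq_ind: u => s IH /=; congr _.+1; rewrite -/(pforest_size _).
rewrite (pforest_size_perm (s2 := [seq canon v | v <- s])) ?perm_sort //.
rewrite /pforest_size -map_comp; congr sumn.
exact/eq_in_map.
Qed.

Lemma canonK u : canon (canon u) = canon u.
Proof.
elim/ptree_seq_ind: u => s IH /=; congr PNode.
have -> : [seq canon v | v <- sort ptree_le [seq canon v | v <- s]] =
    sort ptree_le [seq canon v | v <- s].
  apply: map_id_in => v; rewrite mem_sort => /mapP[w ws ->].
  exact: IH.
by apply: sorted_sort; [exact: ptree_le_trans|exact: sort_ptree_sorted].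
Qed.

Lemma canon_PNodeE s :
  (canon (PNode s) == PNode s) =
  sorted ptree_le s && all (fun v => canon v == v) s.
Proof.
apply/eqP/andP => [/= [h]|[h1 h2] /=].
  split; first by rewrite -h sort_ptree_sorted.
  apply/allP => v; rewrite -h mem_sort => /mapP[w ws ->].
  by rewrite canonK.
have -> : [seq canon v | v <- s] = s.
  by apply: map_id_in => v vs; apply/eqP; exact: (allP h2).
by rewrite sorted_sort //; exact: ptree_le_trans.
Qed.

Lemma tree_iso_canon u v : tree_iso u v -> canon u = canon v.
Proof.
elim=> s1 s2 f fbij _ IH /=; congr PNode; apply: perm_sort_ptree.
have enumE (s : seq ptree) :
    [seq canon v | v <- s] =
    [seq canon (tnth (in_tuple s) i) | i <- enum 'I_(size s)].
  by rewrite -{1}[s]/(tval (in_tuple s)) -{1}(map_tnth_enum (in_tuple s)) -map_comp.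
rewrite (enumE s1) (enumE s2) (eq_map IH).
rewrite (map_comp (fun j => canon (tnth (in_tuple s2) j)) f).
apply: perm_map; apply: uniq_perm.
- by rewrite map_inj_uniq ?enum_uniq //; exact: bij_inj.
- exact: enum_uniq.
move=> j; rewrite mem_enum inE; case: fbij => g fK gK.
by apply/mapP; exists (g j); rewrite ?mem_enum ?gK.
Qed.

(** Equal sorted lists of canonical children come from a permutation of positions, which
    [perm_iotaP] supplies and which is the bijection that [TreeIso] asks for. *)
Lemma canon_tree_iso u v : canon u = canon v -> tree_iso u v.
Proof.
elim/ptree_seq_ind: u v => s1 IH [s2] /= [h].
have hp : perm_eq [seq canon v | v <- s1] [seq canon v | v <- s2].
  by apply/(perm_sortP ptree_le_total ptree_le_trans ptree_le_anti).
have hs : size s1 = size s2 by have := perm_size hp; rewrite !size_map.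
have [Is hIs e] := perm_iotaP (PNode [::]) hp.
rewrite size_map in hIs.
have sIs : size Is = size s2 by rewrite (perm_size hIs) size_iota.
have Ilt (i : 'I_(size s1)) : nth 0 Is i < size s2.
  have : nth 0 Is i \in Is by rewrite mem_nth // sIs -hs.
  by rewrite (perm_mem hIs) mem_iota.
pose f (i : 'I_(size s1)) : 'I_(size s2) := Ordinal (Ilt i).
have finj : injective f.
  move=> i j /(congr1 val)/= /eqP; rewrite nth_uniq ?sIs -?hs //.
    by move/eqP/val_inj.
  by rewrite (perm_uniq hIs) iota_uniq.
apply: (@TreeIso _ _ f).
  by apply: inj_card_bij => //; rewrite !card_ord hs.
move=> i; apply: IH; first exact: mem_tnth.
rewrite !(tnth_nth (PNode [::])) /=.
have := congr1 (fun s => nth (PNode [::]) s i) e.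
rewrite (nth_map (PNode [::])) // (nth_map 0) ?sIs -?hs // => ->.
by rewrite (nth_map (PNode [::])).
Qed.

(** The fuel replaces a well-founded recursion on the size. Only completeness is proved, since
    [polya_forests] filters the list and removes duplicates. *)
Fixpoint all_pforests (fuel n : nat) : seq (seq ptree) :=
  if fuel is f.+1 then
    if n is m.+1 then
      flatten [seq [seq PNode s1 :: s2 | s1 <- all_pforests f i,
                                         s2 <- all_pforests f (m - i)]
              | i <- iota 0 m.+1]
    else [:: [::]]
  else [::].

Lemma all_pforestsS f m : all_pforests f.+1 m.+1 =
  flatten [seq [seq PNode s1 :: s2 | s1 <- all_pforests f i,
                                     s2 <- all_pforests f (m - i)]
          | i <- iota 0 m.+1].
Proof. by []. Qed.

Lemma pforest_size_cons s1 s2 :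
  pforest_size (PNode s1 :: s2) = (pforest_size s1 + pforest_size s2).+1.
Proof. by []. Qed.

Lemma mem_all_pforests f s : pforest_size s < f ->
  s \in all_pforests f (pforest_size s).
Proof.
elim: f s => // f IH [//|[s1] s2]; rewrite pforest_size_cons ltnS => h.
rewrite all_pforestsS; apply/flatten_mapP; exists (pforest_size s1).
  by rewrite mem_iota add0n ltnS leq_addr.
rewrite addKn; apply: allpairs_f; apply: IH; apply: leq_trans h.
  by rewrite ltnS leq_addr.
by rewrite ltnS leq_addl.
Qed.

(* Sorted sequences of canonical trees stand for multisets of Polya trees. *)
Definition polya_forests (n : nat) : seq (seq ptree) :=
  undup [seq s <- all_pforests n.+1 n |
    [&& sorted ptree_le s, all (fun v => canon v == v) s & pforest_size s == n]].

Definition canon_trees (n : nat) : seq ptree :=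
  if n is m.+1 then [seq PNode s | s <- polya_forests m] else [::].

Lemma polya_forests_uniq n : uniq (polya_forests n).
Proof. exact: undup_uniq. Qed.

Lemma mem_polya_forests n s : (s \in polya_forests n) =
  [&& sorted ptree_le s, all (fun v => canon v == v) s & pforest_size s == n].
Proof.
rewrite mem_undup mem_filter; case: and3P => // -[_ _ /eqP <-].
exact: mem_all_pforests.
Qed.

Lemma canon_trees_uniq n : uniq (canon_trees n).
Proof.
case: n => // n; rewrite map_inj_uniq ?polya_forests_uniq //.
by move=> ? ? [].
Qed.

Lemma mem_canon_trees n u :
  (u \in canon_trees n) = (canon u == u) && (nverts u == n).
Proof.
case: n => [|n]; first by case: u => s; rewrite nverts_PNode andbF.
case: u => s; rewrite canon_PNodeE nverts_PNode eqSS /=.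
rewrite mem_map ?mem_polya_forests ?andbA //.
by move=> ? ? [].
Qed.

(** Each isomorphism class is a fibre of [canon] and contains exactly one fixed point of [canon]. *)
Lemma polya_countE n : polya_count n = size (canon_trees n).
Proof.
pose cls (c : ptree) : set ptree := [set v | canon v = c].
have -> : polya_count n = #|` fset_set (cls @` [set` canon_trees n])|%fset.
  rewrite /polya_count; congr (#|` fset_set _|%fset).
  apply/seteqP; split => [A [u /= un <-]|A [c /= cn <-]].
    exists (canon u).
      by rewrite /= mem_canon_trees canonK nverts_canon un !eqxx.
    apply/seteqP; split => v /=; rewrite /cls /=.
      by move=> h; apply: canon_tree_iso.
    by move=> h; rewrite (tree_iso_canon h).
  move: cn; rewrite mem_canon_trees => /andP[/eqP cc /eqP cn].
  exists c => //=; apply/seteqP; split => v /=; rewrite /cls /=.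
    by move/tree_iso_canon => <-.
  by move=> h; apply: canon_tree_iso; rewrite cc.
rewrite fset_set_image; last exact: finite_seq.
rewrite card_in_imfset /=; last first.
  move=> c1 c2; rewrite !in_fset_set; try exact: finite_seq.
  rewrite !inE /= !mem_canon_trees => /andP[/eqP h1 _] /andP[/eqP h2 _] h.
  have : cls c1 c1 by rewrite /cls /= h1.
  by rewrite h /cls /= h1.
have -> : [set` canon_trees n] = [set` [fset c in canon_trees n]%fset].
  by apply/seteqP; split => c /=; rewrite in_fset.
by rewrite set_fsetK card_fseq undup_id ?canon_trees_uniq.
Qed.

Lemma polya_countS n : polya_count n.+1 = size (polya_forests n).
Proof. by rewrite polya_countE size_map. Qed.

(** * Multiplicities in multisets and Polya's recurrence *)

Lemma perm_nseq_count j (u : ptree) s : j <= count_mem u s ->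
  exists s', perm_eq s (nseq j u ++ s').
Proof.
elim: j s => [|j IH] s h; first by exists s.
have us : u \in s by rewrite -has_pred1 has_count; exact: leq_trans h.
have pr := perm_to_rem us.
have [|s' hs'] := IH (rem u s).
  by move: h; rewrite (permP pr) /= eqxx add1n ltnS.
by exists s'; rewrite (permPl pr) /= perm_cons.
Qed.

(** Adding [j] copies of [u] and sorting again (the map [h]) inverts their deletion; forests of size
    [m] are counted by [polya_count m.+1]. *)
Lemma count_polya_forests n d u j : u \in canon_trees d ->
  count (fun s => j <= count_mem u s) (polya_forests n) =
  if j * d <= n then polya_count (n - j * d).+1 else 0.
Proof.
rewrite mem_canon_trees => /andP[uc /eqP ud].
case: ifPn => [jd|]; last first.
  rewrite -ltnNge => jd; apply/eqP; rewrite -leqn0 leqNgt -has_count.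
  apply/hasPn => s; rewrite mem_polya_forests => /and3P[_ _ /eqP sn].
  apply/negP => /perm_nseq_count[s' /pforest_size_perm].
  rewrite sn pforest_size_cat pforest_size_nseq ud => e.
  by move: jd; rewrite e ltnNge leq_addr.
pose h s := sort ptree_le (nseq j u ++ s).
rewrite -size_filter polya_countS -(size_map h (polya_forests _)).
apply: perm_size; apply: uniq_perm.
- by rewrite filter_uniq ?polya_forests_uniq.
- rewrite map_inj_in_uniq ?polya_forests_uniq // => s1 s2.
  rewrite !mem_polya_forests => /and3P[h1 _ _] /and3P[h2 _ _] e.
  apply: (sorted_eq ptree_le_trans ptree_le_anti h1 h2).
  rewrite -(perm_cat2l (nseq j u)).
  by apply/(perm_sortP ptree_le_total ptree_le_trans ptree_le_anti).
move=> s; rewrite mem_filter mem_polya_forests; apply/idP/mapP.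
  move=> /and4P[/perm_nseq_count[s' hs'] ss sc sn].
  exists (sort ptree_le s'); last first.
    rewrite /h; apply: (sorted_eq ptree_le_trans ptree_le_anti ss).
      exact: sort_ptree_sorted.
    rewrite perm_sym perm_sort (permPr hs') perm_cat2l.
    by rewrite perm_sort.
  rewrite mem_polya_forests sort_ptree_sorted all_sort.
  rewrite (pforest_size_perm (s2 := s')) ?perm_sort //=.
  move: sc; rewrite (perm_all _ hs') all_cat => /andP[_ ->] /=.
  rewrite -(eqP sn) (pforest_size_perm hs') pforest_size_cat.
  by rewrite pforest_size_nseq ud addKn.
move=> [s' + ->]; rewrite mem_polya_forests => /and3P[_ sc /eqP sn].
rewrite /h count_sort count_cat count_nseq /= eqxx mul1n leq_addr /=.
rewrite sort_ptree_sorted all_sort all_cat sc all_nseq uc orbT /=.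
rewrite (pforest_size_perm (s2 := nseq j u ++ s')) ?perm_sort //.
by rewrite pforest_size_cat pforest_size_nseq ud sn subnKC.
Qed.

Lemma sum_canon_trees_eq v d : canon v == v ->
  \sum_(u <- canon_trees d) d * (v == u) = d * (nverts v == d).
Proof.
move=> vc; rewrite -big_distrr /=; congr (_ * _).
have <- : (v \in canon_trees d) = (nverts v == d).
  by rewrite mem_canon_trees vc.
rewrite -count_uniq_mem ?canon_trees_uniq // -sum1_count [RHS]big_mkcond /=.
by apply: eq_bigr => u _; rewrite eq_sym; case: eqP.
Qed.

Lemma pforest_size_count n s :
  all (fun v => canon v == v) s -> pforest_size s <= n ->
  pforest_size s = \sum_(1 <= d < n.+1) \sum_(u <- canon_trees d)
                     d * count_mem u s.
Proof.
elim: s => [|v s IH] /=.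
  by move=> _ _; rewrite big1 // => d _; rewrite big1 // => u; rewrite muln0.
move=> /andP[vc sc].
have -> : pforest_size (v :: s) = nverts v + pforest_size s by [].
move=> h; rewrite {1}IH //; last exact: leq_trans (leq_addl _ _) h.
have vn : nverts v <= n by exact: leq_trans (leq_addr _ _) h.
under [RHS]eq_bigr => d _.
  under eq_bigr => u _ do rewrite mulnDr.
  rewrite big_split /= sum_canon_trees_eq //.
  over.
rewrite big_split /=; congr (_ + _).
rewrite (bigD1_seq (nverts v)) ?iota_uniq //=; last first.
  by rewrite mem_index_iota nverts_gt0 ltnS.
rewrite eqxx muln1 big1 ?addn0 // => d.
by rewrite eq_sym => /negbTE ->; rewrite muln0.
Qed.

(* Double counting of the triples [(s, u, j)] with [1 <= j <= count_mem u s],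
   each weighted by the size of [u]: deleting [j] copies of [u] from [s] is a
   bijection. *)
Lemma polya_count_rec n : n * polya_count n.+1 =
  \sum_(1 <= d < n.+1) \sum_(1 <= j < n.+1 | j * d <= n)
     d * polya_count d * polya_count (n - j * d).+1.
Proof.
have -> : n * polya_count n.+1 = \sum_(s <- polya_forests n) pforest_size s.
  rewrite polya_countS big_seq (eq_bigr (fun=> n)); last first.
    by move=> s; rewrite mem_polya_forests => /and3P[_ _ /eqP].
  by rewrite -big_seq big_const_seq count_predT iter_addn_0.
transitivity (\sum_(s <- polya_forests n) \sum_(1 <= d < n.+1)
    \sum_(u <- canon_trees d) d * \sum_(1 <= j < n.+1) (j <= count_mem u s)).
  rewrite !big_seq; apply: eq_bigr => s.
  rewrite mem_polya_forests => /and3P[_ sc /eqP sn].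
  rewrite (pforest_size_count sc (n := n)) ?sn //.
  apply: eq_bigr => d _; apply: eq_bigr => u _; congr (_ * _).
  have cn : count_mem u s <= n.
    apply: leq_trans (count_size _ _) _; rewrite -sn /pforest_size sumnE big_map.
    rewrite -sum1_size; apply: leq_sum => v _; exact: nverts_gt0.
  rewrite (big_cat_nat (n := (count_mem u s).+1)) //=.
  rewrite [X in _ + X]big_nat_cond [X in _ + X]big1 ?addn0; last first.
    by move=> j /andP[/andP[cj _] _]; rewrite leqNgt cj.
  rewrite big_nat_cond (eq_bigr (fun=> 1)); last first.
    by move=> j /andP[/andP[_ jc] _]; rewrite -ltnS jc.
  by rewrite -big_nat_cond sum_nat_const_nat muln1 subSS subn0.
rewrite exchange_big /=; apply: eq_bigr => d _.
rewrite exchange_big /=.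
transitivity (\sum_(u <- canon_trees d) \sum_(1 <= j < n.+1 | j * d <= n)
   d * polya_count (n - j * d).+1).
  rewrite !big_seq; apply: eq_bigr => u ud.
  rewrite -big_distrr exchange_big /= big_distrr /= [RHS]big_mkcond /=.
  apply: eq_bigr => j _.
  rewrite -big_mkcond sum1_count (count_polya_forests _ _ ud).
  by case: ifP => //; rewrite muln0.
rewrite big_const_seq count_predT iter_addn_0 -polya_countE mulnC big_distrr /=.
by apply: eq_bigr => j _; rewrite mulnCA mulnA.
Qed.

End PolyaRecurrence.

(** * Formal power series *)

Section FormalSeries.
Variable R : realType.
Implicit Types f g h e : nat -> R.

Definition cprod f g (n : nat) : R := \sum_(i < n.+1) f i * g (n - i)%N.

(** Coefficients of the derivative [f']. *)
Definition dser f (n : nat) : R := n.+1%:R * f n.+1.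

(** Low coefficients of a product depend on truncations only, so ring laws and the Leibniz rule are
    imported from polynomials. *)
Definition ptrunc (N : nat) f : {poly R} := \poly_(i < N.+1) f i.

Lemma coef_ptrunc N f i : (i <= N)%N -> (ptrunc N f)`_i = f i.
Proof. by move=> h; rewrite coef_poly ltnS h. Qed.

Lemma coefM_low (p q : {poly R}) f g n :
  (forall i, (i <= n)%N -> p`_i = f i) -> (forall i, (i <= n)%N -> q`_i = g i) ->
  (p * q)`_n = cprod f g n.
Proof.
move=> hp hq; rewrite coefM; apply: eq_bigr => i _.
by rewrite hp ?hq ?leq_subr // -ltnS.
Qed.

Lemma cprodE N f g n : (n <= N)%N -> cprod f g n = (ptrunc N f * ptrunc N g)`_n.
Proof.
move=> h; symmetry; apply: coefM_low => i hi; apply: coef_ptrunc;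
  exact: leq_trans hi h.
Qed.

Lemma cprodC f g : cprod f g = cprod g f.
Proof. by apply/funext => n; rewrite !(cprodE (N := n)) // mulrC. Qed.

Lemma cprodA f g h : cprod f (cprod g h) = cprod (cprod f g) h.
Proof.
apply/funext => n.
transitivity ((ptrunc n f * (ptrunc n g * ptrunc n h))`_n).
  by symmetry; apply: coefM_low => i hi; rewrite ?coef_ptrunc // -cprodE.
by rewrite mulrA; apply: coefM_low => i hi; rewrite ?coef_ptrunc // -cprodE.
Qed.

Lemma cprodDl f g h : cprod (f \+ g) h = cprod f h \+ cprod g h.
Proof.
apply/funext => n; rewrite /cprod /= -big_split /=.
by apply: eq_bigr => i _; rewrite mulrDl.
Qed.

Lemma dser_cprod f g : dser (cprod f g) = cprod (dser f) g \+ cprod f (dser g).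
Proof.
apply/funext => n; rewrite /dser /= (cprodE (N := n.+1)) //.
have <- (p : {poly R}) : p^`()`_n = n.+1%:R * p`_n.+1.
  by rewrite coef_deriv mulr_natl.
rewrite derivM coefD; congr (_ + _); apply: coefM_low => i hi;
  by rewrite ?coef_deriv ?coef_ptrunc ?mulr_natl // ltnW.
Qed.

(** * The formal exponential *)

Definition pexp (K : nat) (P : {poly R}) : {poly R} :=
  \sum_(k < K.+1) k`!%:R^-1 *: P ^+ k.

(** Coefficients of [exp f] when [f] has no constant term: both truncations at [n] are then exact.
    The form is that of [D_coef], so that [D_coef] is [expc (dlog_coef R)] by computation. *)
Definition expc f (n : nat) : R := (pexp n (ptrunc n f))`_n.

Lemma coef_exp_low (P : {poly R}) k n : P`_0 = 0 -> (n < k)%N -> (P ^+ k)`_n = 0.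
Proof.
move=> P0; elim: k n => // k IH n nk; rewrite exprS coefM big1 // => -[[|i] hi] _ /=.
  by rewrite P0 mul0r.
by rewrite IH ?mulr0 //; lia.
Qed.

Lemma coef_exp_eq (P Q : {poly R}) k n :
  (forall i, (i <= n)%N -> P`_i = Q`_i) -> (P ^+ k)`_n = (Q ^+ k)`_n.
Proof.
elim: k n => [|k IH] n h; first by rewrite !expr0.
rewrite !exprS !coefM; apply: eq_bigr => i _.
have hi : (i <= n)%N by rewrite -ltnS.
rewrite (h i hi) (IH (n - i)%N) // => j hj.
by apply: h; apply: leq_trans hj _; rewrite leq_subr.
Qed.

Lemma coef_pexp (P : {poly R}) f n K : f 0%N = 0 ->
  (forall i, (i <= n)%N -> P`_i = f i) -> (n <= K)%N ->
  (pexp K P)`_n = expc f n.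
Proof.
move=> f0 hP nK; have P0 : P`_0 = 0 by rewrite hP.
rewrite /expc /pexp !coef_sum.
transitivity (\sum_(k < n.+1) (k`!%:R^-1 *: P ^+ k)`_n).
  rewrite (big_ord_widen _ (fun k => (k`!%:R^-1 *: P ^+ k)`_n) (nK : n.+1 <= K.+1)%N).
  rewrite [RHS]big_mkcond; apply: eq_bigr => k _; case: ltnP => // h.
  by rewrite coefZ coef_exp_low ?mulr0.
apply: eq_bigr => k _; rewrite !coefZ; congr (_ * _); apply: coef_exp_eq => i hi.
by rewrite hP // coef_ptrunc.
Qed.

Lemma expc0 f : f 0%N = 0 -> expc f 0 = 1.
Proof. by move=> f0; rewrite /expc /pexp big_ord1 expr0 fact0 invr1 scale1r coef1. Qed.

Lemma expc_ext f g n : (forall i, (i <= n)%N -> f i = g i) -> expc f n = expc g n.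
Proof.
move=> h; rewrite /expc; congr ((pexp n _)`_n); apply/polyP => i.
by rewrite !coef_poly; case: ltnP => // hi; rewrite h.
Qed.

Lemma deriv_pexp K (P : {poly R}) : (pexp K.+1 P)^`() = P^`() * pexp K P.
Proof.
rewrite /pexp big_ord_recl expr0 derivD derivZ derivC scaler0 add0r.
rewrite linear_sum mulr_sumr; apply: eq_bigr => k _.
rewrite lift0 /= derivZ deriv_exp -scalerAr /= -[X in _ *: X = _]scaler_nat scalerA.
by congr (_ *: _); rewrite factS natrM invfM mulrAC mulVf ?mul1r ?pnatr_eq0.
Qed.

Lemma dser_expc f : f 0%N = 0 -> dser (expc f) = cprod (dser f) (expc f).
Proof.
move=> f0; apply/funext => n.
rewrite /dser /= -(coef_pexp (P := ptrunc n.+1 f) (K := n.+1) f0) //; last first.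
  by move=> i hi; rewrite coef_ptrunc.
rewrite mulr_natl -coef_deriv deriv_pexp.
apply: coefM_low => i hi; first by rewrite coef_deriv coef_ptrunc // mulr_natl.
by apply: coef_pexp => // j hj; rewrite coef_ptrunc //; lia.
Qed.

(** The equation [e' = f' e] determines the coefficients of [e] one after the other from [e 0 = 1].
    This is how combinatorial recurrences are recognized as exponentials. *)
Lemma expc_unique f e : f 0%N = 0 -> e 0%N = 1 ->
  (forall n, dser e n = cprod (dser f) e n) -> e = expc f.
Proof.
move=> f0 e0 he; apply/funext; elim/ltn_ind => -[|n] IH; first by rewrite expc0.
have n0 : n.+1%:R != 0 :> R by rewrite pnatr_eq0.
apply: (mulfI n0); rewrite -!/(dser _ n) dser_expc // he; apply: eq_bigr => i _.
by rewrite IH // ltnS leq_subr.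
Qed.

Lemma expcD f g : f 0%N = 0 -> g 0%N = 0 ->
  expc (f \+ g) = cprod (expc f) (expc g).
Proof.
move=> f0 g0; symmetry; apply: expc_unique.
- by rewrite /= f0 g0 addr0.
- by rewrite /cprod big_ord1 !expc0 // mulr1.
have -> : dser (f \+ g) = dser f \+ dser g.
  by apply/funext => n; rewrite /dser /= mulrDr.
move=> n; rewrite dser_cprod !dser_expc // cprodDl -cprodA /=; congr (_ + _).
by rewrite !cprodA (cprodC (expc f) (dser g)).
Qed.

Lemma expc_pow f n N : f 0%N = 0 -> (n <= N)%N ->
  expc f n = \sum_(k < N.+1) k`!%:R^-1 * (ptrunc N f ^+ k)`_n.
Proof.
move=> f0 nN; rewrite -(coef_pexp (P := ptrunc N f) (K := N) f0) //.
  by rewrite /pexp coef_sum; apply: eq_bigr => k _; rewrite coefZ.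
by move=> i hi; rewrite coef_ptrunc //; exact: leq_trans hi nN.
Qed.

Lemma cprod_ge0 f g n : (forall i, 0 <= f i) -> (forall i, 0 <= g i) -> 0 <= cprod f g n.
Proof. by move=> hf hg; apply: sumr_ge0 => i _; rewrite mulr_ge0. Qed.

Lemma ler_cprod f f' g g' n : (forall i, 0 <= f i) -> (forall i, 0 <= g i) ->
  (forall i, f i <= f' i) -> (forall i, g i <= g' i) -> cprod f g n <= cprod f' g' n.
Proof. by move=> hf hg hff hgg; apply: ler_sum => i _; apply: ler_pM. Qed.

Lemma ptrunc_exp_ge0 f N k i : (forall i, 0 <= f i) -> 0 <= (ptrunc N f ^+ k)`_i.
Proof.
move=> hf; elim: k i => [|k IH] i; first by rewrite expr0 coef1 ler0n.
rewrite exprS coefM; apply: sumr_ge0 => j _; apply: mulr_ge0 => //.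
by rewrite coef_poly; case: ifP.
Qed.

Lemma expc_ge0 f n : (forall i, 0 <= f i) -> 0 <= expc f n.
Proof.
move=> hf; rewrite /expc /pexp coef_sum; apply: sumr_ge0 => k _.
by rewrite coefZ mulr_ge0 ?ptrunc_exp_ge0 // invr_ge0 ler0n.
Qed.

(* [exp f - 1 <= f exp f] coefficientwise *)
Lemma expc_le_cprod f n : (forall i, 0 <= f i) -> f 0%N = 0 ->
  expc f n.+1 <= cprod f (expc f) n.+1.
Proof.
move=> hf f0; have n0 : 0 < n.+1%:R :> R by rewrite ltr0n.
(* With [exp f] differentiated, the factor [i + 1] carried by each coefficient of [f'] is at most
   [n + 1]. *)
rewrite -(ler_pM2l n0) -/(dser (expc f) n) dser_expc //.
rewrite /cprod [X in _ * X]big_ord_recl f0 mul0r add0r mulr_sumr.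
apply: ler_sum => i _; rewrite /dser lift0 subSS mulrA.
apply: ler_wpM2r; first exact: expc_ge0.
by apply: ler_wpM2r => //; rewrite ler_nat.
Qed.

End FormalSeries.

(** * The functional equation of the Polya series *)

Lemma big_dvdn_reindex (V : Type) (idx : V) (op : Monoid.com_law idx) N j
    (F : nat -> nat -> V) : (0 < j)%N ->
  \big[op/idx]_(1 <= m < N.+1 | (j %| m)%N) F (m %/ j)%N m =
  \big[op/idx]_(1 <= d < N.+1 | (j * d <= N)%N) F d (j * d)%N.
Proof.
move=> j0; rewrite -big_filter -[RHS]big_filter.
transitivity (\big[op/idx]_(m <- [seq (j * d)%N |
    d <- [seq d <- index_iota 1 N.+1 | (j * d <= N)%N]]) F (m %/ j)%N m).
  apply: perm_big; apply: uniq_perm.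
  - by rewrite filter_uniq ?iota_uniq.
  - rewrite map_inj_uniq ?filter_uniq ?iota_uniq // => a b /eqP.
    by rewrite eqn_pmul2l // => /eqP.
  move=> m; rewrite mem_filter mem_index_iota; apply/idP/mapP.
    move=> /and3P[jm m1 mN]; exists (m %/ j)%N; last by rewrite mulnC divnK.
    rewrite mem_filter mem_index_iota mulnC divnK // -ltnS mN /=.
    by rewrite divn_gt0 // dvdn_leq // ltnS (leq_trans (leq_div _ _)).
  move=> [d]; rewrite mem_filter mem_index_iota => /and3P[jd d1 dN ->].
  by rewrite dvdn_mulr //= muln_gt0 j0 d1 ltnS.
by rewrite big_map; apply: eq_bigr => d _; rewrite mulKn.
Qed.

(** Grouping the terms by [m = j * d] makes the inner sum the coefficient of [z^m] in [z] times the
    derivative of [\sum_(j >= 1) T(z^j) / j], so the recurrence becomes a differential equation for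
    an exponential. *)
Lemma polya_count_rec_dvd n : (n * polya_count n.+1 =
  \sum_(1 <= m < n.+1)
    (\sum_(1 <= j < n.+1 | j %| m) (m %/ j) * polya_count (m %/ j)) *
    polya_count (n - m).+1)%N.
Proof.
rewrite polya_count_rec; under [RHS]eq_bigr => m _ do
  rewrite big_distrl /= big_mkcond /=.
rewrite exchange_big /=.
under [LHS]eq_bigr => m _ do rewrite big_mkcond /=.
rewrite exchange_big /=; rewrite big_nat_cond [RHS]big_nat_cond.
apply: eq_bigr => j /andP[/andP[j0 _] _].
rewrite -!big_mkcond /=.
by rewrite (big_dvdn_reindex _ n (fun d m => d * polya_count d * polya_count (n - m).+1)%N).
Qed.

Section PolyaSeries.
Variable R : realType.

Definition tser (n : nat) : R := (polya_count n)%:R.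

Lemma tser0 : tser 0 = 0.
Proof. by rewrite /tser polya_countE. Qed.

Lemma tser1 : tser 1 = 1.
Proof. by rewrite /tser polya_countS. Qed.

Lemma tser_ge0 n : 0 <= tser n.
Proof. exact: ler0n. Qed.

Lemma dlog_coef0 : dlog_coef R 0 = 0.
Proof. by rewrite /dlog_coef big_geq. Qed.

Lemma dlog_coef_ge0 n : 0 <= dlog_coef R n.
Proof. by apply: sumr_ge0 => i _; rewrite divr_ge0 ?ler0n. Qed.

Lemma dlog_tserE n m : (0 < m <= n)%N ->
  m%:R * (dlog_coef R m + tser m) =
  (\sum_(1 <= j < n.+1 | j %| m) (m %/ j) * polya_count (m %/ j))%N%:R.
Proof.
move=> /andP[m0 mn]; rewrite big_mkcond (big_cat_nat (n := m.+1)) //=.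
rewrite [X in (_ + X)%N]big1_seq ?addn0; last first.
  move=> j /andP[_]; rewrite mem_index_iota => /andP[mj _].
  by rewrite gtnNdvd.
rewrite -big_mkcond big_ltn_cond // dvd1n divn1 natrD natrM mulrDr addrC.
congr (_ + _); rewrite /dlog_coef mulr_sumr natr_sum.
apply: eq_bigr => j jm; rewrite natrM /tser mulrCA [RHS]mulrC; congr (_ * _).
have [q ->] := dvdnP jm; case: j jm => [|j] jm.
  by rewrite muln0 divn0 mul0r.
by rewrite mulnK // natrM mulfK // pnatr_eq0.
Qed.

Lemma tserS_expc : (fun n => tser n.+1) = expc (dlog_coef R \+ tser).
Proof.
apply: expc_unique; rewrite ?tser1 //=.
  by rewrite dlog_coef0 tser0 addr0.
move=> n; rewrite /dser /tser -natrM polya_count_rec_dvd.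
rewrite natr_sum big_add1 /= big_mkord; apply: eq_bigr => i _.
rewrite natrM subSS; congr (_ * _).
by rewrite -/(tser i.+1) (dlog_tserE (n := n.+1)) // ltn_ord.
Qed.

Lemma tserS n : tser n.+1 = cprod (D_coef R) (expc tser) n.
Proof.
have -> : D_coef R = expc (dlog_coef R) by [].
by rewrite -expcD ?dlog_coef0 ?tser0 // -tserS_expc.
Qed.

End PolyaSeries.

(** * Decorated plane trees *)

Section DecoratedForests.

(* A plane forest together with the list, in preorder, of the sizes of the
   D-forests attached to its vertices. *)
Definition dforest : Type := (seq ptree * seq nat)%type.

Definition dforest_of_size (n : nat) (x : dforest) : bool :=
  (size x.2 == pforest_size x.1) && (pforest_size x.1 + sumn x.2 == n)%N.

(** The forest [y] becomes the children of the new first root, [z] the remaining trees; this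
    concatenation of decorations is the preorder one. *)
Definition dgraft (a : nat) (y z : dforest) : dforest :=
  (PNode y.1 :: z.1, a :: y.2 ++ z.2).

(* Ways of distributing [m] among the D-forest of the first root, the
   children of the first root and the remaining trees. *)
Definition dforest_splits (m : nat) : seq (nat * nat) :=
  [seq (a, b) | a <- iota 0 m.+1, b <- iota 0 (m - a).+1].

(** This list indexes sums of weights, so it must be exact and free of duplicates: the sizes [1],
    [a], [b] and [m - a - b] of the four pieces are tracked. *)
Fixpoint all_dforests (fuel n : nat) : seq dforest :=
  if fuel is f.+1 then
    if n is m.+1 then
      [seq dgraft q.1.1 q.2.1 q.2.2 |
        q <- [seq (p, yz) | p <- dforest_splits m,
               yz <- [seq (y, z) | y <- all_dforests f p.2,
                                   z <- all_dforests f (m - p.1 - p.2)]]]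
    else [:: ([::], [::])]
  else [::].

Lemma all_dforestsS f m : all_dforests f.+1 m.+1 =
  [seq dgraft q.1.1 q.2.1 q.2.2 |
    q <- [seq (p, yz) | p <- dforest_splits m,
           yz <- [seq (y, z) | y <- all_dforests f p.2,
                               z <- all_dforests f (m - p.1 - p.2)%N]]].
Proof. by []. Qed.

Arguments all_dforests : simpl never.

Lemma dforest_splitsP m p : reflect (p.1 + p.2 <= m)%N (p \in dforest_splits m).
Proof.
case: p => a b; apply: (iffP allpairsPdep) => [[a' [b' []]]|ab].
  by rewrite !mem_iota !add0n /= => ha hb [-> ->]; lia.
rewrite /= in ab; exists a, b; rewrite !mem_iota !add0n; split => //; lia.
Qed.

Lemma all_dforestsP f n : (n < f)%N ->
  uniq (all_dforests f n) /\
  forall x, (x \in all_dforests f n) = dforest_of_size n x.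
Proof.
elim: f n => // f IH [|m] mf.
  split => // -[[|[s] s'] l]; rewrite /= mem_seq1 /dforest_of_size.
    by rewrite /pforest_size /= add0n; case: l.
  by rewrite pforest_size_cons addSn andbF.
have F1 b : (b <= m)%N -> uniq (all_dforests f b) /\
  forall x, (x \in all_dforests f b) = dforest_of_size b x.
  by move=> bm; apply: IH; lia.
have hQ a b y z :
    ((a, b), (y, z)) \in [seq (p, yz) | p <- dforest_splits m,
           yz <- [seq (y, z) | y <- all_dforests f p.2,
                               z <- all_dforests f (m - p.1 - p.2)%N]] <->
    [/\ (a + b <= m)%N, dforest_of_size b y & dforest_of_size (m - a - b) z].
  split.
    move=> /allpairsPdep[p [yz [/dforest_splitsP hp + e]]].
    case: e hp => <- <- /= ab /allpairsP[[y' z'] /= [+ + [-> ->]]].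
    by rewrite (F1 _ _).2 ?(F1 _ _).2 //; lia.
  move=> [ab hy hz]; apply/allpairsPdep; exists (a, b), (y, z).
  split=> //; first exact/dforest_splitsP.
  apply/allpairsP; exists (y, z); split => //=.
    by rewrite (F1 _ _).2 //; lia.
  by rewrite (F1 _ _).2 //; lia.
rewrite all_dforestsS; split.
  rewrite map_inj_in_uniq.
    apply: allpairs_uniq_dep.
    - apply: allpairs_uniq_dep => [|a _|]; rewrite ?iota_uniq //.
      by move=> [a b] [a' b'] _ _ /= [-> ->].
    - move=> [a b] /dforest_splitsP /= ab; apply: allpairs_uniq.
      + by apply: (F1 b _).1; lia.
      + by apply: (F1 (m - a - b)%N _).1; lia.
      + by move=> [? ?] [? ?].
    - by move=> [a b] [a' b'] _ _ /= [-> ->].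
  move=> [[a b] [[s l] [s' l']]] [[a2 b2] [[s2 l2] [s2' l2']]].
  move=> /hQ[ab /andP[/= /eqP hl /eqP hb] /andP[/= /eqP hl' _]].
  move=> /hQ[ab2 /andP[/= /eqP hl2 /eqP hb2] /andP[/= /eqP hl2' _]].
  (* Once the plane forests agree, the length of the first decoration list is known, so the
     concatenation can be cut and grafting is injective. *)
  rewrite /dgraft /= => -[e1 e2 ea] /eqP; rewrite eqseq_cat ?hl ?hl2 ?e1 //.
  move=> /andP[/eqP e3 /eqP e4].
  by rewrite -hb -hb2 e1 e2 ea e3 e4.
move=> [s l]; apply/mapP/idP.
  move=> [[[a b] [y z]]].
  move=> /hQ[/= ab /andP[/eqP hy1 /eqP hy2] /andP[/eqP hz1 /eqP hz2] [-> ->]].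
  rewrite /dforest_of_size /= pforest_size_cons size_cat sumn_cat.
  apply/andP; split; apply/eqP; lia.
case: s => [|[s] s']; first by case: l => // ?; rewrite /dforest_of_size /= andbC.
rewrite /dforest_of_size pforest_size_cons /=.
case: l => // a l /=; rewrite eqSS => /andP[/eqP h1 /eqP h2].
pose k := pforest_size s.
have hk : (k <= size l)%N by rewrite h1 leq_addr.
have kE : k = pforest_size s by [].
have el : sumn l = (sumn (take k l) + sumn (drop k l))%N.
  by rewrite -sumn_cat cat_take_drop.
exists ((a, (k + sumn (take k l))%N), ((s, take k l), (s', drop k l))).
  apply/hQ; split; first lia.
    by rewrite /dforest_of_size /= size_takel // !eqxx.
  have -> : (m - a - (k + sumn (take k l)) = pforest_size s' + sumn (drop k l))%N.
    lia.
  by rewrite /dforest_of_size /= size_drop h1 addKn !eqxx.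
by rewrite /dgraft /= cat_take_drop.
Qed.

Definition dforests n := all_dforests n.+1 n.

Lemma dforests_uniq n : uniq (dforests n).
Proof. by have [] := all_dforestsP (ltnSn n). Qed.

Lemma mem_dforests n x : (x \in dforests n) = dforest_of_size n x.
Proof. by have [_] := all_dforestsP (ltnSn n). Qed.

Lemma perm_all_dforests f n : (n < f)%N -> perm_eq (all_dforests f n) (dforests n).
Proof.
move=> /all_dforestsP[u m]; apply: uniq_perm => // [|x].
  exact: dforests_uniq.
by rewrite m mem_dforests.
Qed.

(** * Weights of decorated forests *)

Definition pforest_outdegs (s : seq ptree) : seq nat :=
  flatten [seq outdegs v | v <- s].

Lemma size_outdegs u : size (outdegs u) = nverts u.
Proof.
elim/ptree_seq_ind: u => s IH /=; congr _.+1.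
rewrite size_flatten /shape -map_comp; congr sumn.
exact/eq_in_map.
Qed.

Lemma size_pforest_outdegs s : size (pforest_outdegs s) = pforest_size s.
Proof.
rewrite size_flatten /shape -map_comp; congr sumn.
by apply: eq_map => u; exact: size_outdegs.
Qed.

Variable R : realType.
Implicit Types w : nat -> R.

Definition dforest_weight w (x : dforest) : R :=
  \prod_(p <- zip x.2 (pforest_outdegs x.1)) (w p.1 / (p.2)`!%:R).

Lemma dforest_weight_graft w a y z : size y.2 = pforest_size y.1 ->
  dforest_weight w (dgraft a y z) =
  w a / (size y.1)`!%:R * dforest_weight w y * dforest_weight w z.
Proof.
move=> hy; rewrite /dforest_weight.
have -> : zip (dgraft a y z).2 (pforest_outdegs (dgraft a y z).1) =
    (a, size y.1) :: zip y.2 (pforest_outdegs y.1) ++ zip z.2 (pforest_outdegs z.1).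
  by rewrite -zip_cat // size_pforest_outdegs.
by rewrite big_cons big_cat mulrA.
Qed.

Definition forest_sum w (j n : nat) : R :=
  \sum_(x <- dforests n | size x.1 == j) dforest_weight w x.

Definition tree_sum w n := forest_sum w 1 n.

(** The factor [1 / (size x.1)!] is the one that the root above the forest contributes to the
    weight. *)
Definition children_sum w (n : nat) : R :=
  \sum_(x <- dforests n) dforest_weight w x / (size x.1)`!%:R.

Lemma dforests0 : dforests 0 = [:: ([::], [::])].
Proof. by []. Qed.

Lemma forest_sum_n0 w j : forest_sum w j 0 = (j == 0)%:R.
Proof.
rewrite /forest_sum dforests0 big_cons big_nil /= eq_sym.
by case: eqP => // _; rewrite /dforest_weight /= big_nil addr0.
Qed.

Lemma forest_sum_0n w n : forest_sum w 0 n.+1 = 0.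
Proof.
rewrite /forest_sum big_seq_cond big1 // => -[[|u s] l] /andP[] //.
rewrite mem_dforests /dforest_of_size /= => /andP[].
by rewrite /pforest_size /=; case: l.
Qed.

Lemma forest_sum_rec w j n : forest_sum w j.+1 n.+1 =
  cprod w (cprod (children_sum w) (forest_sum w j)) n.
Proof.
rewrite {1}/forest_sum {1}/dforests all_dforestsS big_mkcond big_map.
rewrite big_allpairs_dep big_allpairs_dep.
rewrite -[iota 0 n.+1]/(index_iota 0 n.+1) big_mkord; apply: eq_bigr => a _.
rewrite -[iota 0 _.+1]/(index_iota 0 (n - a).+1) big_mkord mulr_sumr.
apply: eq_bigr => b _; rewrite big_allpairs_dep /= /children_sum mulr_suml mulr_sumr.
have ha := ltn_ord a; have hb := ltn_ord b.
rewrite (perm_big _ (perm_all_dforests _)) /=; last lia.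
rewrite !big_seq; apply: eq_bigr => y.
rewrite mem_dforests => /andP[/eqP hy _].
rewrite (perm_big _ (perm_all_dforests _)) /=; last lia.
rewrite /forest_sum [X in _ = _ * (_ * X)]big_mkcond !mulr_sumr; apply: eq_bigr => z _.
rewrite eqSS; case: eqP => _; last by rewrite !mulr0.
by rewrite dforest_weight_graft // !mulrA; congr (_ * _); exact: mulrAC.
Qed.

Lemma tree_sum0 w : tree_sum w 0 = 0.
Proof. exact: forest_sum_n0. Qed.

Lemma tree_sumS_children w n : tree_sum w n.+1 = cprod w (children_sum w) n.
Proof.
rewrite /tree_sum forest_sum_rec; congr (cprod _ _ n); apply/funext => i.
rewrite cprodC /cprod big_ord_recl forest_sum_n0 mul1r subn0 big1 ?addr0 // => k _.
by rewrite lift0 forest_sum_0n mul0r.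
Qed.

Lemma forest_sumS w j : forest_sum w j.+1 = cprod (tree_sum w) (forest_sum w j).
Proof.
apply/funext => -[|n].
  by rewrite forest_sum_n0 /cprod big_ord1 tree_sum0 mul0r.
rewrite forest_sum_rec cprodA /cprod [RHS]big_ord_recl tree_sum0 mul0r add0r.
by apply: eq_bigr => i _; rewrite lift0 tree_sumS_children subSS.
Qed.

Lemma forest_sum_pow w j N n : (n <= N)%N ->
  forest_sum w j n = (ptrunc N (tree_sum w) ^+ j)`_n.
Proof.
elim: j n => [|j IH] n nN.
  rewrite expr0 coef1; case: n nN => [|n] _; first by rewrite forest_sum_n0.
  by rewrite forest_sum_0n.
rewrite exprS forest_sumS; symmetry; apply: coefM_low => i hi.
  by rewrite coef_ptrunc //; lia.
by rewrite IH //; lia.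
Qed.

(** Forests of [k] trees have the [k]-th power of the tree series as generating function, so the
    root factor [1 / k!] produces the exponential series; a forest of size [n] has at most [n]
    trees, whence the truncation. *)
Lemma children_sum_expc w : children_sum w = expc (tree_sum w).
Proof.
apply/funext => n; rewrite (expc_pow (N := n)) ?tree_sum0 //.
under eq_bigr => k _ do rewrite -forest_sum_pow // /forest_sum big_mkcond mulr_sumr.
rewrite exchange_big /= /children_sum !big_seq; apply: eq_bigr => x.
rewrite mem_dforests => /andP[_ /eqP hx].
have xn : (size x.1 < n.+1)%N.
  rewrite ltnS -hx (leq_trans _ (leq_addr _ _)) // /pforest_size sumnE big_map.
  by rewrite -sum1_size; apply: leq_sum => v _; exact: nverts_gt0.
rewrite (bigD1 (Ordinal xn)) //= eqxx big1 ?addr0 1?mulrC // => i.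
rewrite -val_eqE /= eq_sym => /negbTE ->; exact: mulr0.
Qed.

Lemma tree_sumS w n : tree_sum w n.+1 = cprod w (expc (tree_sum w)) n.
Proof. by rewrite tree_sumS_children children_sum_expc. Qed.

End DecoratedForests.

Section DecompositionProbability.
Variable R : realType.

Definition cutoff (M : nat) (w : nat -> R) (m : nat) : R :=
  if (m < M)%N then w m else 0.

Lemma tree_sum_D_coef : tree_sum (D_coef R) = tser R.
Proof.
apply/funext; elim/ltn_ind => -[|n] IH; first by rewrite tree_sum0 tser0.
rewrite tree_sumS tserS; apply: eq_bigr => i _; congr (_ * _).
by apply: expc_ext => k hk; apply: IH; lia.
Qed.

(** One forest of size at least [M] puts a factor [0] into the product, so truncating [D] restricts
    the sum to the event [max_forest < M]. *)
Lemma dforest_weight_cutoff M (u : ptree) (l : seq nat) : size l = nverts u ->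
  dforest_weight (cutoff M (D_coef R)) ([:: u], l) =
  if (max_forest (u, l) < M)%N then weight R (u, l) else 0.
Proof.
move=> hl; rewrite /dforest_weight /pforest_outdegs /= cats0.
rewrite (big_nth (0%N, 0%N)) size_zip size_outdegs hl minnn big_mkord.
have e (i : 'I_(nverts u)) : nth (0%N, 0%N) (zip l (outdegs u)) i =
    (nth 0%N l i, nth 0%N (outdegs u) i).
  by rewrite nth_zip //= hl size_outdegs.
case: ifPn => h.
  apply: eq_bigr => i _; rewrite e /= /cutoff ifT //.
  by apply: leq_ltn_trans h; exact: (leq_bigmax i).
have [i hi] : exists i : 'I_(nverts u), (M <= nth 0%N l i)%N.
  rewrite -leqNgt in h; have u0 : (0 < #|'I_(nverts u)|)%N.
    by rewrite card_ord nverts_gt0.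
  have [i hi] := @bigop.eq_bigmax _ (fun i : 'I_(nverts u) => nth 0%N l i) u0.
  by exists i; rewrite -hi.
by rewrite (bigD1 i) //= e /= /cutoff ltnNge hi mul0r mul0r.
Qed.

Lemma decomp_prob_seq n (P : pred decomposition) :
  decomp_prob R n [set x | P x] =
  (\sum_(x <- dforests n | size x.1 == 1%N)
     if P (head (PNode [::]) x.1, x.2) then weight R (head (PNode [::]) x.1, x.2) else 0)
  / tser R n.
Proof.
pose g (x : dforest) : decomposition := (head (PNode [::]) x.1, x.2).
pose l := [seq g x | x <- dforests n & size x.1 == 1%N].
have hl x : (x \in l) <-> decompositions n x.
  case: x => u m; split.
    move=> /mapP[[s m']]; rewrite mem_filter mem_dforests /=.
    case: s => [|v [|? ?]] //= /andP[/eqP h1 /eqP h2] [-> ->].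
    by move: h1 h2; rewrite /pforest_size /= addn0.
  move=> [/= h1 h2]; apply/mapP; exists ([:: u], m) => //.
  rewrite mem_filter mem_dforests /dforest_of_size /= /pforest_size /= addn0.
  by rewrite h1 h2 !eqxx.
have ul : uniq l.
  rewrite map_inj_in_uniq ?filter_uniq ?dforests_uniq // => -[s m] [s' m'].
  rewrite !mem_filter /g /=; case: s => [|v [|? ?]] //=.
  by case: s' => [|v' [|? ?]] //= _ _ [-> ->].
rewrite /decomp_prob.
have -> : decompositions n `&` [set x | P x] = [set` [seq x <- l | P x]].
  apply/seteqP; split => x /=; rewrite mem_filter.
    by move=> [/hl -> ->].
  by move=> /andP[? /hl].
rewrite -fsbig_seq ?filter_uniq // big_filter big_map big_filter_cond.
by rewrite mulr_suml big_mkcondr /=; apply: eq_bigr => x _; case: ifP; rewrite ?mul0r.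
Qed.

Lemma decomp_prob_lt n M : decomp_prob R n [set x | (max_forest x < M)%N] =
  tree_sum (cutoff M (D_coef R)) n / tser R n.
Proof.
rewrite (decomp_prob_seq n (fun x => max_forest x < M)%N); congr (_ / _).
rewrite /tree_sum /forest_sum big_seq_cond [RHS]big_seq_cond; apply: eq_bigr => -[s l] /andP[].
rewrite mem_dforests /=; case: s => [|u [|? ?]] //= /andP[/eqP] /= h _ _.
by rewrite dforest_weight_cutoff // h /pforest_size /= addn0.
Qed.

Lemma decomp_prob_range n M1 M2 : (M1 <= M2)%N ->
  decomp_prob R n [set x | (M1 <= max_forest x < M2)%N] =
  (tree_sum (cutoff M2 (D_coef R)) n - tree_sum (cutoff M1 (D_coef R)) n) / tser R n.
Proof.
move=> M12; rewrite mulrBl -!decomp_prob_lt.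
rewrite (decomp_prob_seq n (fun x => max_forest x < M1)%N).
rewrite (decomp_prob_seq n (fun x => max_forest x < M2)%N).
rewrite (decomp_prob_seq n (fun x => M1 <= max_forest x < M2)%N).
rewrite -mulrBl; congr (_ / _); rewrite -sumrB; apply: eq_bigr => x _.
case: (ltnP _ M1) => h1 /=; last by rewrite subr0.
by rewrite (leq_trans h1 M12) subrr.
Qed.

End DecompositionProbability.

(** * Coefficient inequalities *)

Section CoefficientBounds.
Variable R : realType.
Implicit Types w : nat -> R.
Local Notation D := (D_coef R).
Local Notation t := (tser R).

Lemma D_coefE : D = expc (dlog_coef R).
Proof. by []. Qed.

Lemma D_coef_ge0 n : 0 <= D n.
Proof. by rewrite D_coefE expc_ge0 // => i; exact: dlog_coef_ge0. Qed.

Lemma D_coef0 : D 0 = 1.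
Proof. by rewrite D_coefE expc0 // dlog_coef0. Qed.

Lemma expc_pow_le (f : nat -> R) k n : (forall i, 0 <= f i) -> f 0%N = 0 ->
  (ptrunc n f ^+ k)`_n / k`!%:R <= expc f n.
Proof.
move=> hf f0; have [kn|kn] := leqP k n; last first.
  rewrite coef_exp_low ?coef_ptrunc // mul0r; exact: expc_ge0.
rewrite (expc_pow (N := n)) // (bigD1 (Ordinal (kn : k < n.+1)%N)) //= mulrC lerDl.
apply: sumr_ge0 => i _; apply: mulr_ge0; first by rewrite invr_ge0 ler0n.
exact: ptrunc_exp_ge0.
Qed.

Lemma expc_ge (f : nat -> R) n : (forall i, 0 <= f i) -> f 0%N = 0 -> f n <= expc f n.
Proof.
move=> hf f0; apply: le_trans (expc_pow_le 1 n hf f0).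
by rewrite expr1 coef_ptrunc // divr1.
Qed.

Lemma expc_tser_le n : expc t n <= t n.+1.
Proof.
rewrite tserS /cprod big_ord_recl D_coef0 mul1r subn0 lerDl.
apply: sumr_ge0 => i _; apply: mulr_ge0; first exact: D_coef_ge0.
exact/expc_ge0/tser_ge0.
Qed.

Lemma tser_leS n : t n <= t n.+1.
Proof.
by apply: le_trans (expc_tser_le n); apply: expc_ge; [exact: tser_ge0|exact: tser0].
Qed.

Lemma tser_ge1 n : 1 <= t n.+1.
Proof. by elim: n => [|n]; rewrite ?tser1 // => /le_trans; apply; exact: tser_leS. Qed.

Lemma tser_gt0 n : 0 < t n.+1.
Proof. exact: lt_le_trans (tser_ge1 n). Qed.

(** A tree of size [a] and one of size [b] are hung under a new root; the [1/2] is that of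
    [T^2 / 2!] in [exp T]. *)
Lemma tser_join a b : t a * t b / 2 <= t (a + b).+1.
Proof.
apply: le_trans (expc_tser_le _).
apply: le_trans (expc_pow_le 2 _ (@tser_ge0 R) (tser0 R)).
rewrite ler_pM2r ?invr_gt0 ?ltr0n // expr2 -(cprodE _ _ (leqnn _)).
have ha : (a < (a + b).+1)%N by lia.
rewrite /cprod (bigD1 (Ordinal ha)) //= addKn lerDl.
by apply: sumr_ge0 => i _; rewrite mulr_ge0 // tser_ge0.
Qed.

(** The term [T(z^2) / 2] of the exponent alone gives this. It reaches even indices only, which is
    why the lower tail is stated for a cutoff [h.*2]. *)
Lemma D_coef_double m : (0 < m)%N -> t m / 2 <= D m.*2.
Proof.
move=> m0; rewrite D_coefE.
apply: le_trans (expc_ge _ (@dlog_coef_ge0 R) (dlog_coef0 R)).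
rewrite /dlog_coef big_ltn_cond; last by lia.
rewrite dvdn2 odd_double /= divn2 doubleK lerDl.
by apply: sumr_ge0 => i _; rewrite divr_ge0 ?ler0n.
Qed.

Definition theta (n : nat) : R := n%:R * t n.

(** Here [theta] is [z T']. With [T = z exp (S + T)] one has [z T' = T (1 + z S' + z T')], and [S]
    has nonnegative coefficients. *)
Lemma theta_ge n : t n + cprod t theta n <= theta n.
Proof.
rewrite /theta; case: n => [|[|n]].
- by rewrite /cprod big_ord1 !tser0 !mul0r addr0.
- rewrite /cprod !big_ord_recl big_ord0 /= /bump /= addn0 subnn tser0 tser1.
  lra.
rewrite (_ : n.+2%:R = 1 + n.+1%:R); last by rewrite -natr1 addrC.
rewrite mulrDl mul1r lerD2l.
have := congr1 (fun f => dser f n) (tserS_expc R).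
rewrite /= dser_expc /=; last by rewrite /= dlog_coef0 tser0 addr0.
rewrite -tserS_expc => h; rewrite -[leRHS]/(dser (fun k => t k.+1) n) h.
rewrite cprodC /cprod big_ord_recl /= mul0r mul0r add0r big_ord_recr /=.
rewrite /bump /= add1n subnn tser0 mulr0 addr0; apply: ler_sum => i _.
have hi := ltn_ord i; rewrite add1n (_ : (n.+2 - i.+1 = (n - i).+1)%N); last lia.
apply: ler_wpM2r; first exact: tser_ge0.
by rewrite /dser /= ler_wpM2l ?ler0n // lerDr dlog_coef_ge0.
Qed.

Lemma dforest_weight_ge0 w x : (forall m, 0 <= w m) -> 0 <= dforest_weight w x.
Proof. by move=> hw; apply: prodr_ge0 => p _; rewrite divr_ge0. Qed.

Lemma tree_sum_ge0 w n : (forall m, 0 <= w m) -> 0 <= tree_sum w n.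
Proof. by move=> hw; apply: sumr_ge0 => x _; apply: dforest_weight_ge0. Qed.

Lemma ler_tree_sum w w' n : (forall m, 0 <= w m) -> (forall m, w m <= w' m) ->
  tree_sum w n <= tree_sum w' n.
Proof.
move=> hw hww; apply: ler_sum => x _; apply: ler_prod => p _.
by rewrite divr_ge0 //= ler_wpM2r // invr_ge0 ler0n.
Qed.

Lemma cutoff_ge0 M m : 0 <= cutoff M D m.
Proof. by rewrite /cutoff; case: ifP => // _; exact: D_coef_ge0. Qed.

Lemma cutoff_le M m : cutoff M D m <= D m.
Proof. by rewrite /cutoff; case: ifP => // _; exact: D_coef_ge0. Qed.

Lemma tree_sum_cutoff_le M n : tree_sum (cutoff M D) n <= t n.
Proof.
rewrite -tree_sum_D_coef; apply: ler_tree_sum => m; first exact: cutoff_ge0.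
exact: cutoff_le.
Qed.

Lemma tree_sum_cutoff_mono M M' n : (M <= M')%N ->
  tree_sum (cutoff M D) n <= tree_sum (cutoff M' D) n.
Proof.
move=> MM'; apply: ler_tree_sum => m; first exact: cutoff_ge0.
rewrite /cutoff; case: (ltnP m M) => h1; first by rewrite (leq_trans h1 MM').
by case: ifP => // _; exact: D_coef_ge0.
Qed.

(** * The excess [T - T_(<M)] *)

Definition tailD (M m : nat) : R := D m - cutoff M D m.

Lemma tailD_ge0 M m : 0 <= tailD M m.
Proof. by rewrite subr_ge0 cutoff_le. Qed.

Definition excess (M n : nat) : R := t n - tree_sum (cutoff M D) n.

Lemma excess_ge0 M n : 0 <= excess M n.
Proof. by rewrite subr_ge0 tree_sum_cutoff_le. Qed.

Lemma excess0 M : excess M 0 = 0.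
Proof. by rewrite /excess tser0 tree_sum0 subr0. Qed.

(** With [x] the excess and [v = T - x]: [exp T - exp v = (exp x - 1) exp v <= x exp x exp v = x exp
    T]. *)
Lemma expc_excess M n :
  expc t n - expc (tree_sum (cutoff M D)) n <= cprod (excess M) (expc t) n.
Proof.
set v := tree_sum _.
have v0 : v 0%N = 0 by exact: tree_sum0.
have vge k : 0 <= v k by apply: tree_sum_ge0 => m; exact: cutoff_ge0.
have et : expc t = cprod (expc (excess M)) (expc v).
  rewrite -expcD ?excess0 //; congr expc; apply/funext => k /=.
  by rewrite /excess subrK.
rewrite [in X in X - _]et [in X in _ <= X]et cprodA.
rewrite /cprod big_ord_recl expc0 ?excess0 // mul1r subn0 addrAC subrr add0r.
rewrite [leRHS]big_ord_recl big_ord1 excess0 mul0r mul0r add0r.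
apply: ler_sum => i _; apply: ler_wpM2r; first exact: expc_ge0.
by apply: expc_le_cprod; [exact: excess_ge0|exact: excess0].
Qed.

(** The excess is [z (D_(>=M) exp T + D_(<M) (exp T - exp v))] with [v] the truncated tree series.
    Then [z exp T <= T] bounds the first part since [d_0 = 1], and the second is at most
    [z D x exp T = x T]. *)
Lemma excess_rec M n :
  excess M n <= cprod (tailD M) t n + cprod (excess M) t n.
Proof.
case: n => [|n].
  by rewrite excess0 /cprod !big_ord1 tser0 !mulr0 addr0.
have shift (f : nat -> R) : cprod f t n.+1 = cprod f (cprod D (expc t)) n.
  rewrite /cprod big_ord_recr /= subnn tser0 mulr0 addr0.
  by apply: eq_bigr => i _; rewrite subSn ?tserS // -ltnS.
rewrite !shift /excess tserS tree_sumS.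
set v := tree_sum _.
have -> : cprod D (expc t) n - cprod (cutoff M D) (expc v) n =
  cprod (tailD M) (expc t) n + cprod (cutoff M D) (fun k => expc t k - expc v k) n.
  rewrite /cprod -sumrB -big_split /=; apply: eq_bigr => i _.
  by rewrite /tailD; ring.
have et0 k : 0 <= expc t k by apply: expc_ge0; exact: tser_ge0.
apply: lerD.
  apply: ler_cprod => // [i|i]; first exact: tailD_ge0.
  rewrite /cprod big_ord_recl D_coef0 mul1r subn0 lerDl.
  by apply: sumr_ge0 => j _; rewrite mulr_ge0 ?D_coef_ge0.
rewrite -[cprod _ (cprod D _)]/(cprod (excess M) _) cprodA (cprodC (excess M)) -cprodA.
apply: (@le_trans _ _ (cprod (cutoff M D) (cprod (excess M) (expc t)) n)).
  apply: ler_sum => i _; apply: ler_wpM2l; first exact: cutoff_ge0.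
  exact: expc_excess.
apply: ler_sum => i _; apply: ler_wpM2r; last exact: cutoff_le.
by apply: cprod_ge0 => // j; exact: excess_ge0.
Qed.

(* The coefficients of [T / (1 - T)] are bounded by those of [z T'], so the
   linear recursive inequality for the excess can be solved. *)
Lemma excess_le M n : excess M n <= cprod (tailD M) theta n.
Proof.
elim/ltn_ind: n => n IH; apply: le_trans (excess_rec M n) _.
apply: (@le_trans _ _ (cprod (tailD M) (t \+ cprod t theta) n)); last first.
  apply: ler_sum => i _; apply: ler_wpM2l; first exact: tailD_ge0.
  exact: theta_ge.
rewrite (cprodC _ t) (cprodC _ (t \+ _)) cprodDl /= lerD2l.
rewrite (cprodC _ t) -cprodA (cprodC theta).
(* Since [t 0 = 0], the convolution with [t] uses the excess at smaller indices only, where the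
   induction hypothesis applies. *)
apply: ler_sum => -[[|i] hi] _ /=; first by rewrite tser0 !mul0r.
by apply: ler_wpM2l; [exact: tser_ge0|apply: IH; lia].
Qed.

End CoefficientBounds.

(** * Evaluation of nonnegative series *)

Section PartialSums.
Variable R : realType.
Implicit Types (f g w : nat -> R) (P Q : {poly R}) (r x : R).

Definition psum f r (N : nat) : R := \sum_(i < N) f i * r ^+ i.

Lemma psumS f r N : psum f r N.+1 = psum f r N + f N * r ^+ N.
Proof. by rewrite /psum big_ord_recr. Qed.

Lemma psum_horner f r N : psum f r N = (\poly_(i < N) f i).[r].
Proof. by rewrite horner_poly. Qed.

Lemma psum_ge0 f r N : (forall i, 0 <= f i) -> 0 <= r -> 0 <= psum f r N.
Proof. by move=> hf r0; apply: sumr_ge0 => i _; rewrite mulr_ge0 ?exprn_ge0. Qed.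

Lemma psum_homo f r N M : (forall i, 0 <= f i) -> 0 <= r -> (N <= M)%N ->
  psum f r N <= psum f r M.
Proof.
move=> hf r0; elim: M => [|M IH]; first by rewrite leqn0 => /eqP ->.
rewrite leq_eqVlt => /predU1P[->//|/IH /le_trans]; apply.
by rewrite psumS lerDl mulr_ge0 ?exprn_ge0.
Qed.

Lemma psum_le_arg f r x N : (forall i, 0 <= f i) -> 0 <= r -> r <= x ->
  psum f r N <= psum f x N.
Proof.
move=> hf r0 rx; apply: ler_sum => i _; apply: ler_wpM2l => //.
by apply: lerXn2r => //; rewrite nnegrE //; exact: le_trans rx.
Qed.

Lemma psum_le_coef f g r N : (forall i, f i <= g i) -> 0 <= r ->
  psum f r N <= psum g r N.
Proof. by move=> fg r0; apply: ler_sum => i _; rewrite ler_wpM2r ?exprn_ge0. Qed.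

Lemma psum_le_horner P r N : (forall i, 0 <= P`_i) -> 0 <= r ->
  psum (fun i => P`_i) r N <= P.[r].
Proof.
move=> hP r0; rewrite (horner_coef_wide r (leq_maxr N (size P))).
exact: psum_homo (leq_maxl _ _).
Qed.

Lemma horner_le_psum P f r N : (forall i, P`_i <= f i) -> 0 <= r ->
  (size P <= N)%N -> P.[r] <= psum f r N.
Proof.
by move=> hP r0 hN; rewrite (horner_coef_wide r hN); exact: psum_le_coef.
Qed.

Lemma psum_cprod_le f g r N : (forall i, 0 <= f i) -> (forall i, 0 <= g i) ->
  0 <= r -> psum (cprod f g) r N <= psum f r N * psum g r N.
Proof.
move=> hf hg r0; rewrite !psum_horner -hornerM.
set P := \poly_(i < N) f i; set Q := \poly_(i < N) g i.
have h0 (h : nat -> R) : (forall i, 0 <= h i) -> forall i, 0 <= (\poly_(i < N) h i)`_i.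
  by move=> hh i; rewrite coef_poly; case: ifP.
apply: le_trans (psum_le_horner N _ r0); last first.
  by move=> i; rewrite coefM; apply: sumr_ge0 => j _; rewrite mulr_ge0 ?h0.
rewrite -psum_horner; apply: ler_sum => i _; apply: ler_wpM2r.
  exact: exprn_ge0.
rewrite coefM; apply: ler_sum => j _.
have hi := ltn_ord i; have hj := ltn_ord j.
by rewrite !coef_poly !ifT //; lia.
Qed.

Lemma expR_partial_le K x : 0 <= x -> \sum_(k < K) x ^+ k / k`!%:R <= expR x.
Proof.
move=> x0; rewrite -(big_mkord xpredT (fun k => x ^+ k / k`!%:R)).
apply: (@nondecreasing_cvgn_le _ (series (exp_coeff x)) _ (is_cvg_series_exp_coeff x)).
apply: nondecreasing_series => k _ _; exact: exp_coeff_ge0.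
Qed.

Lemma expR_le_partial x c b : 0 <= x -> 0 <= c ->
  (forall K, c * (\sum_(k < K) x ^+ k / k`!%:R) <= b) -> c * expR x <= b.
Proof.
move=> x0; rewrite le_eqVlt => /predU1P[<- /(_ 0%N)|c0 h]; first by rewrite !mul0r.
rewrite -ler_pdivlMl //; apply: limr_le; first exact: is_cvg_series_exp_coeff.
near=> K; rewrite /= ler_pdivlMl // /series /= big_mkord; exact: h.
Unshelve. all: by end_near.
Qed.

Lemma horner_pexp K P r : (pexp K P).[r] = \sum_(k < K.+1) P.[r] ^+ k / k`!%:R.
Proof.
rewrite /pexp horner_sum; apply: eq_bigr => k _.
by rewrite hornerZ horner_exp mulrC.
Qed.

Lemma ler_coef_exp P Q k n : (forall i, 0 <= P`_i) ->
  (forall i, (i <= n)%N -> P`_i <= Q`_i) -> 0 <= (P ^+ k)`_n <= (Q ^+ k)`_n.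
Proof.
move=> P0; elim: k n => [|k IH] n PQ; first by rewrite !expr0 lexx andbT coef1 ler0n.
rewrite !exprS !coefM.
have IH' (i : 'I_n.+1) : 0 <= (P ^+ k)`_(n - i) <= (Q ^+ k)`_(n - i).
  by apply: IH => j hj; apply: PQ; lia.
apply/andP; split.
  by apply: sumr_ge0 => i _; rewrite mulr_ge0 //; have /andP[] := IH' i.
apply: ler_sum => i _; have /andP[h1 h2] := IH' i; apply: ler_pM => //.
by apply: PQ; rewrite -ltnS.
Qed.

Lemma coef_pexp_le K P f i : f 0%N = 0 -> (forall i, 0 <= P`_i) ->
  (forall i, P`_i <= f i) -> (pexp K P)`_i <= expc f i.
Proof.
move=> f0 P0 Pf; rewrite (expc_pow f0 (leq_maxr K i)) /pexp coef_sum.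
have f_ge0 j : 0 <= f j by exact: le_trans (P0 j) (Pf j).
have hK : (K.+1 <= (maxn K i).+1)%N by rewrite ltnS leq_maxl.
rewrite [leRHS](bigID (fun k : 'I__ => (k < K.+1)%N)) /=.
rewrite (big_ord_widen _ (fun k => (k`!%:R^-1 *: P ^+ k)`_i) hK).
apply: ler_wpDr.
  by apply: sumr_ge0 => k _; rewrite mulr_ge0 ?invr_ge0 ?ler0n ?ptrunc_exp_ge0.
apply: ler_sum => k _; rewrite coefZ; apply: ler_wpM2l; first by rewrite invr_ge0 ler0n.
have PQ j : (j <= i)%N -> P`_j <= (ptrunc (maxn K i) f)`_j.
  by move=> hj; rewrite coef_ptrunc ?Pf // (leq_trans hj) // leq_maxr.
by have /andP[] := ler_coef_exp k P0 PQ.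
Qed.

Lemma psum_expc_le f r N : (forall i, 0 <= f i) -> f 0%N = 0 -> 0 <= r ->
  psum (expc f) r N <= expR (psum f r N).
Proof.
move=> hf f0 r0; apply: le_trans (expR_partial_le N.+1 (psum_ge0 N hf r0)).
rewrite [X in _ <= \sum_(k < _) X ^+ _ / _]psum_horner -horner_pexp.
set P := \poly_(i < N) f i.
have P0 i : 0 <= P`_i by rewrite coef_poly; case: ifP.
apply: le_trans (psum_le_horner N _ r0); last first.
  move=> i; rewrite /pexp coef_sum; apply: sumr_ge0 => k _; rewrite coefZ.
  have /andP[h _] := ler_coef_exp k (n := i) (Q := P) P0 (fun _ _ => lexx _).
  by rewrite mulr_ge0 // invr_ge0 ler0n.
apply: ler_sum => i _; apply: ler_wpM2r; first exact: exprn_ge0.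
have hi := ltn_ord i.
rewrite -(coef_pexp (P := P) (K := N) f0) //; last exact: ltnW.
by move=> j hj; rewrite coef_poly ifT //; lia.
Qed.

(* [A = z w exp A] at the level of coefficients *)
Definition tree_like w (A : nat -> R) : Prop :=
  [/\ forall i, 0 <= w i, forall i, 0 <= A i, A 0%N = 0 &
      forall n, A n.+1 = cprod w (expc A) n].

Lemma psum_shift f r N : f 0%N = 0 ->
  psum f r N.+1 = r * psum (fun i => f i.+1) r N.
Proof.
move=> f0; rewrite /psum big_ord_recl f0 mul0r add0r mulr_sumr.
by apply: eq_bigr => i _; rewrite lift0 exprS mulrCA.
Qed.

Lemma tree_like_upper w A r N : tree_like w A -> 0 <= r ->
  psum A r N.+1 <= r * psum w r N * expR (psum A r N).
Proof.
move=> [w0 A0 A00 hA] r0; rewrite psum_shift // -mulrA; apply: ler_wpM2l => //.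
rewrite (_ : (fun i => A i.+1) = cprod w (expc A)); last exact/funext.
apply: le_trans (psum_cprod_le N w0 _ r0) _.
  by move=> i; apply: expc_ge0.
by apply: ler_wpM2l; [exact: psum_ge0|exact: psum_expc_le].
Qed.

(** The truncations of [w] and of [exp A] are polynomials, and [z] times their product has
    coefficients at most those of [A]; a long enough partial sum of [A] therefore dominates its
    value. *)
Lemma tree_like_lower w A r b : tree_like w A -> 0 <= r ->
  (forall N, psum A r N <= b) ->
  forall N, r * psum w r N * expR (psum A r N) <= b.
Proof.
move=> [w0 A0 A00 hA] r0 hb N.
apply: expR_le_partial => [||K]; first exact: psum_ge0.
  by rewrite mulr_ge0 ?psum_ge0.
case: K => [|K].
  by rewrite big_ord0 mulr0; apply: le_trans (hb 0%N); exact: psum_ge0.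
rewrite [X in _ * (\sum_(k < _) X ^+ _ / _)]psum_horner -horner_pexp.
rewrite [psum w r N]psum_horner.
set P := \poly_(i < N) A i; set W := \poly_(i < N) w i.
have P0 i : 0 <= P`_i by rewrite coef_poly; case: ifP.
have PA i : P`_i <= A i by rewrite coef_poly; case: ifP.
have W0 i : 0 <= W`_i by rewrite coef_poly; case: ifP.
have Ww i : W`_i <= w i by rewrite coef_poly; case: ifP.
have E0 i : 0 <= (pexp K P)`_i.
  rewrite /pexp coef_sum; apply: sumr_ge0 => k _; rewrite coefZ.
  have /andP[h _] := ler_coef_exp k (n := i) (Q := P) P0 (fun _ _ => lexx _).
  by rewrite mulr_ge0 // invr_ge0 ler0n.
rewrite -mulrA -hornerM; apply: le_trans (hb (size (W * pexp K P)).+1).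
rewrite psum_shift //; apply: ler_wpM2l => //.
apply: horner_le_psum => // i; rewrite hA coefM; apply: ler_sum => j _.
by apply: ler_pM => //; apply: coef_pexp_le.
Qed.

(** Each further term preserves the bound: [expR (-1) * expR 1 = 1]. The criterion is applied to [T]
    itself just beyond [rho] and to the truncated tree series. *)
Lemma tree_like_le1 w A r : tree_like w A -> 0 <= r ->
  (forall N, r * psum w r N <= expR (-1)) -> forall N, psum A r N <= 1.
Proof.
move=> hA r0 h; elim=> [|N IH]; first by rewrite /psum big_ord0.
apply: le_trans (tree_like_upper N hA r0) _.
have [w0 _ _ _] := hA.
rewrite (_ : 1 = expR (-1) * expR 1); last by rewrite -expRD addrC subrr expR0.
by apply: ler_pM; rewrite ?ler_expR ?expR_ge0 // mulr_ge0 ?psum_ge0.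
Qed.

Lemma tree_like_tser : tree_like (D_coef R) (tser R).
Proof.
split; [exact: D_coef_ge0|exact: tser_ge0|exact: tser0|exact: tserS].
Qed.

Lemma tree_like_tree_sum w : (forall i, 0 <= w i) -> tree_like w (tree_sum w).
Proof.
move=> w0; split => //; [|exact: tree_sum0|exact: tree_sumS].
by move=> i; exact: tree_sum_ge0.
Qed.

End PartialSums.

(** * The radius of convergence *)

Section SeriesValue.
Variable R : realType.
Implicit Types (f w A : nat -> R) (r a b c x y : R).

Definition pbounded f r : Prop := exists B, forall N, psum f r N <= B.

(* The sum of the series; junk unless [pbounded f r]. *)
Definition pval f r : R := sup (range (psum f r)).

Lemma psum_le_pval f r N : pbounded f r -> psum f r N <= pval f r.
Proof.
move=> [B hB]; apply: ub_le_sup; last by exists N.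
by exists B => _ [M _ <-].
Qed.

Lemma pval_le f r b : (forall N, psum f r N <= b) -> pval f r <= b.
Proof.
move=> h; apply: ge_sup; first by exists (psum f r 0), 0%N.
by move=> _ [M _ <-].
Qed.

Lemma nondecreasing_psum f r : (forall i, 0 <= f i) -> 0 <= r ->
  nondecreasing_seq (psum f r).
Proof. by move=> hf r0 N M; exact: psum_homo. Qed.

Lemma cvg_psum f r : (forall i, 0 <= f i) -> 0 <= r -> pbounded f r ->
  psum f r @ \oo --> pval f r.
Proof.
move=> hf r0 [B hB]; apply: nondecreasing_cvgn; first exact: nondecreasing_psum.
by exists B => _ [M _ <-].
Qed.

Lemma cvgn_pseriesP f r : (forall i, 0 <= f i) -> 0 <= r ->
  cvgn (pseries f r) <-> pbounded f r.
Proof.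
move=> hf r0; have -> : pseries f r = psum f r.
  by apply/funext => N; rewrite /pseries /series /= big_mkord.
split=> [h|h]; last by apply: cvgP; exact: cvg_psum.
exists (limn (psum f r)) => N; apply: nondecreasing_cvgn_le => //.
exact: nondecreasing_psum.
Qed.

Lemma pbounded_le f r x : (forall i, 0 <= f i) -> 0 <= r -> r <= x ->
  pbounded f x -> pbounded f r.
Proof.
move=> hf r0 rx [B hB]; exists B => N; apply: le_trans (hB N).
exact: psum_le_arg.
Qed.

Lemma pval_le_arg f r x : (forall i, 0 <= f i) -> 0 <= r -> r <= x ->
  pbounded f x -> pval f r <= pval f x.
Proof.
move=> hf r0 rx hx; apply: pval_le => N; apply: le_trans (psum_le_pval N hx).
exact: psum_le_arg.
Qed.

Lemma tree_like_pval w A r : tree_like w A -> 0 <= r ->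
  pbounded w r -> pbounded A r -> pval A r = r * pval w r * expR (pval A r).
Proof.
move=> hA r0 bw bA; have [w0 A0 A00 _] := hA.
apply/eqP; rewrite eq_le; apply/andP; split.
  apply: pval_le => N; apply: le_trans (psum_homo A0 r0 (leqnSn N)) _.
  apply: le_trans (tree_like_upper N hA r0) _.
  apply: ler_pM; rewrite ?expR_ge0 ?ler_expR ?psum_le_pval //.
    by rewrite mulr_ge0 ?psum_ge0.
  by rewrite ler_wpM2l ?psum_le_pval.
have : (r * psum w r N * expR (psum A r N)) @[N --> \oo] -->
    r * pval w r * expR (pval A r).
  apply: cvgM; first by apply: cvgMr; exact: cvg_psum.
  apply: continuous_cvg; first exact: continuous_expR.
  exact: cvg_psum.
move/cvgr_to_le; apply; near=> N; apply: tree_like_lower => // M.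
exact: psum_le_pval.
Unshelve. all: by end_near.
Qed.

(** Convexity of the power function. Multiplying the induction hypothesis by [b] leaves the
    nonnegative defect [(c - b) (b - a) (c^m - a^m)]. *)
Lemma expn_convex a b c m : 0 <= a -> a <= b -> b <= c ->
  (c - a) * b ^+ m <= (c - b) * a ^+ m + (b - a) * c ^+ m.
Proof.
move=> a0 ab bc; elim: m => [|m IH]; first by rewrite !expr0; lra.
rewrite !exprS; have b0 : 0 <= b by lra.
have := ler_wpM2l b0 IH.
have h : 0 <= (c - b) * (b - a) * (c ^+ m - a ^+ m).
  rewrite mulr_ge0 //; first by rewrite mulr_ge0 // subr_ge0.
  by rewrite subr_ge0 lerXn2r // ?nnegrE; lra.
by lra.
Qed.

(** A chord bound standing in for a derivative: the increment of a series is controlled by its value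
    at a larger point. *)
Lemma psum_convex f a b c N : (forall i, 0 <= f i) -> 0 <= a -> a <= b -> b <= c ->
  a < c -> psum f b N <= psum f a N + (b - a) / (c - a) * psum f c N.
Proof.
move=> hf a0 ab bc ac; rewrite mulr_sumr -big_split /=; apply: ler_sum => i _.
rewrite mulrCA -mulrDr; apply: ler_wpM2l => //.
have h := expn_convex i a0 ab bc; have ca : 0 < c - a by rewrite subr_gt0.
rewrite -(ler_pM2l ca) mulrDr mulrA mulrCA mulfV ?mulr1 ?gt_eqF //.
apply: le_trans h _; rewrite lerD2r; apply: ler_wpM2r; first exact: exprn_ge0.
by lra.
Qed.

Lemma bernoulli_ge x n : 0 <= x <= 1 -> 1 - n%:R * x <= (1 - x) ^+ n.
Proof.
move=> /andP[x0 x1]; elim: n => [|n IH]; first by rewrite expr0; lra.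
rewrite exprS -natr1; have h : 0 <= 1 - x by lra.
have := ler_wpM2l h IH.
have : 0 <= n%:R * x * x by rewrite !mulr_ge0.
by lra.
Qed.

Lemma bernoulli_le x n : 0 <= x <= 1 -> (1 - x) ^+ n * (1 + n%:R * x) <= 1.
Proof.
move=> /andP[x0 x1]; elim: n => [|n IH]; first by rewrite expr0; lra.
apply: le_trans IH; rewrite exprSr -mulrA; apply: ler_wpM2l.
  by rewrite exprn_ge0 //; lra.
rewrite -natr1; have : 0 <= (n%:R + 1) * x * x by rewrite !mulr_ge0 // addr_ge0.
by lra.
Qed.

End SeriesValue.

Section Radius.
Variable R : realType.
Local Notation D := (D_coef R).
Local Notation t := (tser R).
Local Notation rho := (polya_radius R).

(** Since [T] has no constant term, [T(r^i) <= r^(i - 2) T(r^2)]; the rest is a geometric sum, with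
    the factors [1 / i] dropped. *)
Lemma psum_dlog_le (r : R) N : 0 <= r -> r < 1 ->
  psum (dlog_coef R) r N <= psum t (r ^+ 2) N / (1 - r).
Proof.
move=> r0 r1; have t0 := @tser_ge0 R.
have step i : (2 <= i)%N -> psum t (r ^+ i) N <= r ^+ (i - 2) * psum t (r ^+ 2) N.
  move=> i2; rewrite mulr_sumr; apply: ler_sum => -[[|k] hk] _ /=.
    by rewrite tser0 !mul0r mulr0.
  rewrite mulrCA; apply: ler_wpM2l => //.
  rewrite -!exprM -exprD ler_wiXn2l //; first exact: ltW.
  by nia.
case: N step => [|N] step; first by rewrite /psum !big_ord0 mul0r.
apply: (@le_trans _ _ (\sum_(2 <= i < N.+1) psum t (r ^+ i) N.+1)).
  rewrite /psum -(big_mkord xpredT (fun m => dlog_coef R m * r ^+ m)).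
  rewrite big_ltn // dlog_coef0 mul0r add0r.
  have -> : \sum_(1 <= m < N.+1) dlog_coef R m * r ^+ m =
      \sum_(1 <= m < N.+1) \sum_(2 <= i < N.+1)
        (if (i %| m)%N then t (m %/ i)%N / i%:R * r ^+ m else 0).
    rewrite big_nat_cond [RHS]big_nat_cond; apply: eq_bigr => m /andP[/andP[m1 mN] _].
    rewrite /dlog_coef mulr_suml big_mkcond /=.
    rewrite [RHS](big_cat_nat (n := m.+1)) //= [X in _ = _ + X]big1_seq ?addr0 //.
    by move=> i /andP[_]; rewrite mem_index_iota => /andP[mi _]; rewrite gtnNdvd.
  rewrite exchange_big /=; apply: ler_sum_nat => i /andP[i2 iN].
  have i0 : (0 < i)%N by lia.
  rewrite -big_mkcond (big_dvdn_reindex _ N (fun k m => t k / i%:R * r ^+ m)) //.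
  rewrite -(big_mkord xpredT (fun k => t k * (r ^+ i) ^+ k)).
  rewrite [leRHS]big_ltn // tser0 mul0r add0r big_mkcond /=.
  apply: ler_sum_nat => k _.
  have h0 : 0 <= t k * (r ^+ i) ^+ k by rewrite mulr_ge0 // exprn_ge0 // exprn_ge0.
  case: ifP => // _; rewrite exprM; apply: ler_wpM2r.
    by rewrite exprn_ge0 // exprn_ge0.
  rewrite ler_pdivrMr ?ltr0n // ler_peMr // ler1n; lia.
apply: (@le_trans _ _ (\sum_(2 <= i < N.+1) r ^+ (i - 2) * psum t (r ^+ 2) N.+1)).
  by apply: ler_sum_nat => i /andP[i2 _]; exact: step.
rewrite -mulr_suml mulrC; apply: ler_wpM2l.
  by apply: psum_ge0 => //; exact: exprn_ge0.
have -> : \sum_(2 <= i < N.+1) r ^+ (i - 2) = \sum_(0 <= i < N.-1) r ^+ i.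
  case: (N) => [|M]; first by rewrite !big_geq.
  by rewrite -{1}[2%N]add0n big_addn subn2 /=; apply: eq_bigr => i _; rewrite addnK.
rewrite big_mkord -(ler_pM2r (x := 1 - r)) ?subr_gt0 //.
rewrite mulVf ?subr_eq0 1?eq_sym ?lt_eqF //.
have := subrX1 r N.-1; have : 0 <= r ^+ N.-1 by exact: exprn_ge0.
by lra.
Qed.

Lemma psum_D_le (r : R) N : 0 <= r -> r < 1 ->
  psum D r N <= expR (psum t (r ^+ 2) N / (1 - r)).
Proof.
move=> r0 r1; rewrite D_coefE.
apply: le_trans (psum_expc_le N (@dlog_coef_ge0 R) (dlog_coef0 R) r0) _.
by rewrite ler_expR psum_dlog_le.
Qed.

Lemma pbounded_D (r : R) : 0 <= r -> r < 1 -> pbounded t (r ^+ 2) -> pbounded D r.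
Proof.
move=> r0 r1 [B hB]; exists (expR (B / (1 - r))) => N.
apply: le_trans (psum_D_le N r0 r1) _; rewrite ler_expR ler_wpM2r //.
by rewrite invr_ge0 subr_ge0 ltW.
Qed.

Lemma psum_D_ge1 (r : R) N : 0 <= r -> 1 <= psum D r N.+1.
Proof.
move=> r0; rewrite /psum big_ord_recl D_coef0 expr0 mulr1 lerDl.
by apply: sumr_ge0 => i _; rewrite mulr_ge0 ?D_coef_ge0 ?exprn_ge0.
Qed.

(** At [r = 1 / (2 e)] the bound [1/2] reproduces itself: [T(r) <= 1/2] gives [D(r) <= exp (1/2)],
    hence [r D(r) exp (T(r)) <= r e = 1/2]. *)
Lemma pbounded_tser_small : exists2 r : R, 0 < r & pbounded t r.
Proof.
have e1 : 1 <= expR 1 :> R by rewrite -[leLHS]expR0 ler_expR.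
exists (expR (-1) / 2); first by rewrite divr_gt0 ?expR_gt0.
set r := expR (-1) / 2; have r0 : 0 < r by rewrite divr_gt0 ?expR_gt0.
have r2 : r <= 1 / 2.
  by rewrite /r ler_pM2r ?invr_gt0 // expRN invf_le1 ?expR_gt0.
exists (1 / 2) => N; elim: N => [|N IH]; first by rewrite /psum big_ord0.
apply: le_trans (tree_like_upper N (tree_like_tser R) (ltW r0)) _.
have hsq : psum t (r ^+ 2) N / (1 - r) <= 1 / 2.
  have h : psum t (r ^+ 2) N <= r * psum t r N.
    rewrite mulr_sumr; apply: ler_sum => -[[|k] hk] _ /=.
      by rewrite tser0 !mul0r mulr0.
    rewrite mulrCA; apply: ler_wpM2l; first exact: tser_ge0.
    rewrite -exprM -exprS ler_wiXn2l ?(ltW r0) //; [lra|lia].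
  rewrite ler_pdivrMr; last lra.
  apply: le_trans h _; have := ler_wpM2l (ltW r0) IH; lra.
have hD : psum D r N * expR (psum t r N) <= expR 1.
  apply: (@le_trans _ _ (expR (1 / 2) * expR (1 / 2))); last first.
    by rewrite -expRD ler_expR; lra.
  apply: ler_pM; rewrite ?expR_ge0 ?ler_expR //.
    by apply: psum_ge0; [exact: D_coef_ge0|exact: ltW].
  have r1 : r < 1 by lra.
  by apply: le_trans (psum_D_le N (ltW r0) r1) _; rewrite ler_expR.
rewrite -mulrA; apply: le_trans (ler_wpM2l (ltW r0) hD) _.
by rewrite /r mulrAC -expRD addrC subrr expR0.
Qed.

(** From [D >= 1] the value [y = T(r)] satisfies [r <= y exp (- y) <= 1 / e]. The set whose supremum
    is [rho] is thus bounded above, without which [sup] would be meaningless. *)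
Lemma pbounded_tser_le (r : R) : 0 <= r -> pbounded t r -> r <= expR (-1).
Proof.
move=> r0 bt; case: (ltrP 0 r) => [{}r0|r0']; last exact: le_trans r0' (expR_ge0 _).
set y := pval t r.
have h N : r * expR (psum t r N) <= y.
  apply: (@le_trans _ _ (r * psum D r N.+1 * expR (psum t r N.+1))).
    apply: ler_pM; rewrite ?expR_ge0 ?(ltW r0) //.
      by rewrite ler_peMr ?(ltW r0) // psum_D_ge1 // ltW.
    by rewrite ler_expR psum_homo ?(ltW r0) //; exact: tser_ge0.
  apply: tree_like_lower; [exact: tree_like_tser|exact: ltW|].
  by move=> M; exact: psum_le_pval.
have y0 : 0 < y by apply: lt_le_trans (h 0%N); rewrite mulr_gt0 ?expR_gt0.
have yr : 0 < y / r by rewrite divr_gt0.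
have : y <= ln (y / r).
  apply: pval_le => N; rewrite -ler_expR lnK ?posrE //.
  by rewrite ler_pdivlMr // mulrC.
rewrite -ler_expR lnK ?posrE // ler_pdivlMr // => hy.
have h1 := expR_ge1Dx (y - 1); rewrite addrC subrK expRD in h1.
rewrite expRN -[leRHS]mul1r ler_pdivlMr ?expR_gt0 //.
rewrite -(ler_pM2l (expR_gt0 y)) mulr1 mulrA; apply: le_trans (ler_wpM2r (expR_ge0 1) hy) _.
by rewrite -ler_pdivlMr ?expR_gt0 // -expRN.
Qed.

(** * Values of the series at the radius *)

Lemma polya_radiusE : rho = sup [set r : R | 0 <= r /\ pbounded t r].
Proof.
rewrite /polya_radius; congr sup; apply/seteqP; split => r /= [r0 h]; split => //.
  by apply/(cvgn_pseriesP (@tser_ge0 R) r0).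
by apply/(cvgn_pseriesP (@tser_ge0 R) r0).
Qed.

Lemma le_radius (r : R) : 0 <= r -> pbounded t r -> r <= rho.
Proof.
move=> r0 h; rewrite polya_radiusE; apply: ub_le_sup; last by [].
by exists (expR (-1)) => x [x0 hx]; exact: pbounded_tser_le.
Qed.

Lemma radius_gt0 : 0 < rho.
Proof.
have [r r0 h] := pbounded_tser_small; apply: (lt_le_trans r0).
exact: le_radius (ltW r0) h.
Qed.

Lemma radius_lt1 : rho < 1.
Proof.
apply: (@le_lt_trans _ _ (expR (-1))); last by rewrite expR_lt1 ltrN10.
rewrite polya_radiusE; apply: ge_sup; last by move=> x [x0 hx]; exact: pbounded_tser_le.
by have [r r0 h] := pbounded_tser_small; exists r; split => //; exact: ltW.
Qed.

Lemma pbounded_tser_lt (r : R) : 0 <= r -> r < rho -> pbounded t r.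
Proof.
move=> r0; rewrite polya_radiusE => /sup_gt[|x [x0 hx] rx].
  by have [x x0 h] := pbounded_tser_small; exists x; split => //; exact: ltW.
exact: pbounded_le (@tser_ge0 R) r0 (ltW rx) hx.
Qed.

(** The quantity [y exp (- y) = r D(r)] is nondecreasing in [r], while [y = T(r)] is strictly
    increasing. As [y exp (- y)] decreases strictly for [y > 1], a value above [1] cannot occur
    before [rho]. *)
Lemma pval_tser_lt (r : R) : 0 <= r -> r < rho -> pval t r <= 1.
Proof.
move=> r0 rr; rewrite leNgt; apply/negP => y1.
pose r2 := (r + rho) / 2; have [rr2 r2rho] : r < r2 /\ r2 < rho by rewrite /r2; split; lra.
have r20 : 0 <= r2 by lra.
have r21 : r2 < 1 by have := radius_lt1; lra.
have b1 : pbounded t r by exact: pbounded_tser_lt.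
have b2 : pbounded t r2 by exact: pbounded_tser_lt.
have bD2 : pbounded D r2.
  apply: pbounded_D => //; apply: pbounded_le (@tser_ge0 R) _ _ b2.
    exact: exprn_ge0.
  by rewrite expr2 ler_piMr // ltW.
have bD1 : pbounded D r by apply: pbounded_le (@D_coef_ge0 R) r0 (ltW rr2) bD2.
have e1 := tree_like_pval (tree_like_tser R) r0 bD1 b1.
have e2 := tree_like_pval (tree_like_tser R) r20 bD2 b2.
set y := pval t r in y1 e1; set y2 := pval t r2 in e2.
have yy2 : y < y2.
  have : y <= y2 - (r2 - r); last lra.
  (* Two extra terms make sure that the linear term is present; its coefficient is [1], so it alone
     contributes [r2 - r]. *)
  apply: pval_le => N; apply: (le_trans (psum_homo (@tser_ge0 R) r0 (leq_addr 2 N))).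
  rewrite lerBrDr; apply: le_trans (psum_le_pval (N + 2) b2).
  rewrite addn2 /psum !big_ord_recl tser0 !mul0r !add0r tser1 !mul1r !expr1.
  rewrite [in leLHS](addrC r) -addrA [r + _]addrC subrK addrC lerD2l.
  apply: ler_sum => i _; apply: ler_wpM2l; first exact: tser_ge0.
  by apply: lerXn2r; rewrite ?nnegrE // ltW.
have phi : r * pval D r <= r2 * pval D r2.
  apply: ler_pM => //; first by apply: le_trans (psum_le_pval 0 bD1); rewrite /psum big_ord0.
    exact: ltW.
  exact: pval_le_arg (@D_coef_ge0 R) r0 (ltW rr2) bD2.
have h1 : y * expR (y2 - y) <= y2.
  rewrite expRB mulrA ler_pdivrMr ?expR_gt0 // {1}e1 {2}e2 mulrAC.
  by apply: ler_wpM2r; rewrite ?expR_ge0 // ler_wpM2r ?expR_ge0.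
have h2 : 1 + (y2 - y) < expR (y2 - y) by apply: expR_gt1Dx; rewrite gt_eqF // subr_gt0.
have y0 : 0 < y by lra.
have h3 := ltr_pM2l y0 (1 + (y2 - y)) (expR (y2 - y)); rewrite h2 in h3.
by nra.
Qed.

Lemma psum_tser_rho_le1 N : psum t rho N <= 1.
Proof.
rewrite leNgt; apply/negP => P1; set P := psum t rho N in P1.
have rho0 := radius_gt0.
(* A partial sum is continuous at [rho]; [u] makes this explicit, as [(1 - u)^N P >= P - N u P >= (P
   + 1) / 2 > 1]. The [N.+1] avoids a division by zero. *)
pose u : R := (P - 1) / (2 * N.+1%:R * P).
have N0 : 1 <= N.+1%:R :> R by rewrite ler1n.
have den : 0 < 2 * N.+1%:R * P by rewrite !mulr_gt0 //; lra.
have u0 : 0 < u by rewrite divr_gt0 //; lra.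
have uP : N.+1%:R * u * P = (P - 1) / 2.
  rewrite /u; move: (N.+1%:R : R) N0 => M M1.
  by field; apply/andP; split; apply/eqP; lra.
have u1 : u <= 1 by rewrite /u ler_pdivrMr // mul1r; nra.
have b := bernoulli_ge N (x := u); rewrite (ltW u0) u1 in b; move/(_ isT) in b.
have h : psum t (rho * (1 - u)) N <= 1.
  have r0 : 0 <= rho * (1 - u) by rewrite mulr_ge0 ?(ltW rho0) //; lra.
  have r1 : rho * (1 - u) < rho by rewrite gtr_pMr //; lra.
  by apply: le_trans (psum_le_pval N (pbounded_tser_lt r0 r1)) (pval_tser_lt r0 r1).
have h2 : (1 - u) ^+ N * P <= psum t (rho * (1 - u)) N.
  rewrite mulr_sumr; apply: ler_sum => i _.
  rewrite mulrCA exprMn [X in _ <= _ * X]mulrC; apply: ler_wpM2l; first exact: tser_ge0.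
  apply: ler_wpM2r; first by rewrite exprn_ge0 // ltW.
  by apply: ler_wiXn2l; [lra|lra|exact: ltnW].
have h3 : (1 - N%:R * u) * P <= (1 - u) ^+ N * P by rewrite ler_wpM2r //; lra.
have h4 : N%:R * u * P <= N.+1%:R * u * P.
  by rewrite ler_wpM2r ?ler_wpM2r ?ler_nat ?(ltW u0) //; lra.
by lra.
Qed.

Definition sqrt_radius : R := Num.sqrt rho.
Local Notation q := sqrt_radius.

Lemma sqrt_radius_sq : q ^+ 2 = rho.
Proof. by rewrite /q sqr_sqrtr // ltW // radius_gt0. Qed.

Lemma sqrt_radius_gt0 : 0 < q.
Proof. by rewrite sqrtr_gt0 radius_gt0. Qed.

Lemma sqrt_radius_lt1 : q < 1.
Proof.
rewrite -(ltr_sqr (x := q) (y := 1)) ?nnegrE ?ltW ?sqrt_radius_gt0 //.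
by rewrite sqrt_radius_sq expr1n radius_lt1.
Qed.

Lemma radius_lt_sqrt : rho < q.
Proof.
by rewrite -sqrt_radius_sq expr2 gtr_pMr ?sqrt_radius_gt0 ?sqrt_radius_lt1.
Qed.

Lemma pbounded_tser_radius : pbounded t rho.
Proof. by exists 1; exact: psum_tser_rho_le1. Qed.

Lemma pbounded_D_sqrt_radius : pbounded D q.
Proof.
apply: pbounded_D; [exact/ltW/sqrt_radius_gt0|exact: sqrt_radius_lt1|].
by rewrite sqrt_radius_sq; exact: pbounded_tser_radius.
Qed.

Lemma pbounded_D_le (r : R) : 0 <= r -> r <= q -> pbounded D r.
Proof. by move=> r0 rq; exact: pbounded_le (@D_coef_ge0 R) r0 rq pbounded_D_sqrt_radius. Qed.

Lemma pval_D_ge1 (r : R) : 0 <= r -> r <= q -> 1 <= pval D r.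
Proof.
move=> r0 rq; apply: le_trans (psum_D_ge1 0 r0) _.
exact/psum_le_pval/pbounded_D_le.
Qed.

(* Bounds the growth of [D] just beyond [rho]. *)
Definition D_slope : R := rho * pval D q / (q - rho).

Lemma D_slope_gt0 : 0 < D_slope.
Proof.
rewrite divr_gt0 ?subr_gt0 ?radius_lt_sqrt // mulr_gt0 ?radius_gt0 //.
by apply: lt_le_trans (pval_D_ge1 _ (lexx _)); rewrite ?ltr01 ?ltW ?sqrt_radius_gt0.
Qed.

(** The chord from [rho] to [q]. It is stated for every [w] below [D], so that one slope serves all
    truncations of [D]. *)
Lemma psum_perturb (w : nat -> R) d N : (forall i, 0 <= w i) -> (forall i, w i <= D i) ->
  0 <= d -> rho * (1 + d) <= q ->
  psum w (rho * (1 + d)) N <= psum w rho N + d * D_slope.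
Proof.
move=> w0 wD d0 dq; have rho0 := radius_gt0.
have h1 : rho <= rho * (1 + d) by rewrite ler_peMr ?(ltW rho0) // lerDl.
apply: le_trans (psum_convex N w0 (ltW rho0) h1 dq radius_lt_sqrt) _.
rewrite lerD2l (_ : rho * (1 + d) - rho = d * rho); last ring.
rewrite /D_slope -!mulrA; apply: ler_wpM2l => //; apply: ler_wpM2l; first exact: ltW.
rewrite mulrC; apply: ler_wpM2r.
  by rewrite invr_ge0 subr_ge0 ltW // radius_lt_sqrt.
apply: le_trans (psum_le_pval N pbounded_D_sqrt_radius).
by apply: psum_le_coef => //; exact/ltW/sqrt_radius_gt0.
Qed.

Lemma pval_tser_radius_eq : pval t rho = rho * pval D rho * expR (pval t rho).
Proof.
apply: tree_like_pval; [exact: tree_like_tser|exact/ltW/radius_gt0| |].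
  by apply: pbounded_D_le; apply: ltW; [exact: radius_gt0|exact: radius_lt_sqrt].
exact: pbounded_tser_radius.
Qed.

Lemma radius_pval_D_le : rho * pval D rho <= expR (-1).
Proof.
have e := pval_tser_radius_eq; set y := pval t rho in e.
have h := expR_ge1Dx (y - 1); rewrite addrC subrK in h.
have : rho * pval D rho * expR y <= expR (y - 1) by rewrite -e.
by rewrite expRD mulrC ler_pM2l ?expR_gt0.
Qed.

(* Otherwise the series would still converge slightly beyond [rho]. *)
Lemma radius_pval_D : rho * pval D rho = expR (-1).
Proof.
apply/eqP; rewrite eq_le radius_pval_D_le /= leNgt; apply/negP => lt.
have rho0 := radius_gt0; have K0 := D_slope_gt0; have rq := radius_lt_sqrt.
set Y := pval D rho in lt.
have Y1 : 1 <= Y by apply: pval_D_ge1; exact: ltW.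
(* The last bound is what [rho (1 + d) (Y + d D_slope) <= 1 / e] requires, with [d ^ 2 <= d]; the
   second keeps [rho (1 + d)] below [q]. *)
pose d := Num.min 1 (Num.min ((q - rho) / rho)
  ((expR (-1) - rho * Y) / (rho * (Y + 2 * D_slope)))).
have den : 0 < rho * (Y + 2 * D_slope) by rewrite mulr_gt0 //; lra.
have d0 : 0 < d by rewrite !lt_min ltr01 !divr_gt0 // subr_gt0.
have d1 : d <= 1 by rewrite ge_min lexx.
have d2 : rho * (1 + d) <= q.
  have : d <= (q - rho) / rho by rewrite !ge_min lexx orbT.
  by rewrite ler_pdivlMr // => h; lra.
have d3 : d * (rho * (Y + 2 * D_slope)) <= expR (-1) - rho * Y.
  by rewrite -ler_pdivlMr // !ge_min lexx !orbT.
have : rho * (1 + d) <= rho.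
  have r0 : 0 <= rho * (1 + d) by rewrite mulr_ge0 ?(ltW rho0) //; lra.
  apply: le_radius => //; exists 1; apply: (tree_like_le1 (tree_like_tser R)) => // N.
  have h := psum_perturb N (@D_coef_ge0 R) (fun=> lexx _) (ltW d0) d2.
  have hY : psum D rho N <= Y by apply/psum_le_pval/pbounded_D_le; exact: ltW.
  apply: (@le_trans _ _ (rho * (1 + d) * (Y + d * D_slope))).
    by apply: ler_wpM2l => //; lra.
  have : 0 <= rho * D_slope * d * (1 - d).
    by apply: mulr_ge0; [apply: mulr_ge0; [apply: mulr_ge0|]|]; lra.
  by lra.
by apply/negP; rewrite -ltNge ltr_pMr // ltrDl d0.
Qed.

(** The equation is now [y = exp (y - 1)], whose only solution is the point of tangency [y = 1]. *)
Lemma pval_tser_radius : pval t rho = 1.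
Proof.
have e := pval_tser_radius_eq; rewrite radius_pval_D -expRD addrC in e.
apply/eqP; rewrite -subr_eq0; apply: contraT => /expR_gt1Dx.
by rewrite addrC subrK -e ltxx.
Qed.

End Radius.

(** * A lower bound for the number of Polya trees *)

Section TreeCountLowerBound.
Variable R : realType.
Local Notation D := (D_coef R).
Local Notation t := (tser R).
Local Notation rho := (polya_radius R).
Local Notation q := (sqrt_radius R).

(** This is [T(rho) - T(rho (1 - u))], as [T(rho) = 1]. *)
Definition gap (u : R) : R := 1 - pval t (rho * (1 - u)).

Definition gap_sum (u : R) (N : nat) : R :=
  \sum_(n < N) t n * rho ^+ n * (1 - (1 - u) ^+ n).

Lemma gap_sumE u N : gap_sum u N = psum t rho N - psum t (rho * (1 - u)) N.
Proof.
rewrite /gap_sum /psum -sumrB; apply: eq_bigr => n _.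
by rewrite exprMn; ring.
Qed.

Lemma gap_sum_le u N : 0 < u <= 1 -> gap_sum u N <= gap u.
Proof.
move=> /andP[u0 u1]; have rho0 := @radius_gt0 R.
have r0 : 0 <= rho * (1 - u) by rewrite mulr_ge0 ?(ltW rho0) // subr_ge0.
rewrite /gap lerBrDr addrC -lerBrDr; apply: pval_le => M.
rewrite lerBrDr; apply: (@le_trans _ _ (psum t rho (maxn M N))).
  apply: (@le_trans _ _ (psum t (rho * (1 - u)) (maxn M N) + gap_sum u (maxn M N))).
    apply: lerD; first by rewrite psum_homo ?leq_maxl //; exact: tser_ge0.
    rewrite /gap_sum (big_ord_widen _ (fun n : nat => t n * rho ^+ n * (1 - (1 - u) ^+ n))
      (leq_maxr M N)) big_mkcond.
    apply: ler_sum => n _; case: ifP => // _.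
    rewrite mulr_ge0 ?mulr_ge0 ?tser_ge0 ?exprn_ge0 ?(ltW rho0) // subr_ge0.
    by rewrite exprn_ile1 ?subr_ge0 //; lra.
  by rewrite gap_sumE addrC subrK.
exact: psum_tser_rho_le1.
Qed.

Lemma gap_sum_ge u : 0 < gap u -> 0 < u <= 1 -> exists N, gap u / 2 <= gap_sum u N.
Proof.
move=> g0 /andP[u0 u1]; have rho0 := @radius_gt0 R.
have [N hN] : exists N, 1 - gap u / 2 < psum t rho N.
  apply: contrapT => /forallNP h.
  have : pval t rho <= 1 - gap u / 2.
    by apply: pval_le => N; rewrite leNgt; apply/negP; exact: h.
  by rewrite pval_tser_radius; lra.
exists N; rewrite gap_sumE.
have : psum t (rho * (1 - u)) N <= 1 - gap u.
  rewrite /gap subKr; apply: psum_le_pval; apply: pbounded_tser_lt.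
    by rewrite mulr_ge0 ?(ltW rho0) // subr_ge0.
  by rewrite gtr_pMr // gtrBl.
by lra.
Qed.

(** The function vanishes to second order at [0]. The upper bound uses [exp g >= 1 + g]; the lower
    one uses [exp (- g) >= (1 - g / 2)^2], and the polynomial inequality left has defect
    [g^3 (4 - g) / 16]. *)
Lemma quadratic_expR (g : R) : 0 <= g -> g <= 1 ->
  g ^+ 2 / 4 <= 1 - (1 - g) * expR g <= g ^+ 2.
Proof.
move=> g0 g1; have eg := expR_gt0 g; apply/andP; split.
  have h := expR_ge1Dx (- g / 2).
  have h2 : (1 - g / 2) ^+ 2 <= expR (- g).
    have -> : expR (- g) = expR (- g / 2) ^+ 2.
      by rewrite expr2 -expRD; congr expR; lra.
    by rewrite ler_sqr ?nnegrE ?expR_ge0 //; lra.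
  have h3 : 1 - g <= expR (- g) * (1 - g ^+ 2 / 4).
    apply: (@le_trans _ _ ((1 - g / 2) ^+ 2 * (1 - g ^+ 2 / 4))).
      have : 0 <= g ^+ 3 * (4 - g) by rewrite mulr_ge0 ?exprn_ge0 //; lra.
      rewrite !exprS expr0 !mulr1 => ?; lra.
    by apply: ler_wpM2r => //; rewrite expr2; nra.
  have := ler_wpM2r (ltW eg) h3.
  rewrite expRN mulrAC mulVf ?mul1r ?gt_eqF //; lra.
have h := expR_ge1Dx g.
have : 0 <= (1 - g) * (expR g - (1 + g)) by rewrite mulr_ge0 //; lra.
rewrite expr2; lra.
Qed.

(* The square root singularity of [T] at [rho], from
   [1 - e r D(r) = 1 - (1 - g) exp g] and the quadratic behaviour of the right
   hand side at [g = 0]. *)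
Lemma gap_bounds : exists b1 b2 : R, [/\ 0 < b1, 0 < b2 &
  forall u, 0 < u <= 1 -> b1 * Num.sqrt u <= gap u <= b2 * Num.sqrt u].
Proof.
have rho0 := @radius_gt0 R; have rq := @radius_lt_sqrt R; have K0 := @D_slope_gt0 R.
have e0 : 0 < expR 1 :> R by exact: expR_gt0.
set Y := pval D rho.
have bD : pbounded D rho by apply: pbounded_D_le; exact: ltW.
have Y1 : 1 <= Y by apply: pval_D_ge1; exact: ltW.
have [c cE] : exists c : R, c = rho * (D_slope R + Y) by eexists.
have c0 : 0 < c by rewrite cE mulr_gt0 //; lra.
(* The deficit [1 - e x D(x)] lies between [e rho u] and [e c u], and also between [g^2 / 4] and
   [g^2]: hence the [4] under the second root. *)
exists (Num.sqrt (expR 1 * rho)), (Num.sqrt (4 * expR 1 * c)); split.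
- by rewrite sqrtr_gt0 mulr_gt0.
- by rewrite sqrtr_gt0 !mulr_gt0.
move=> u /andP[u0 u1]; set x := rho * (1 - u).
have x0 : 0 <= x by rewrite mulr_ge0 ?(ltW rho0) // subr_ge0.
have xr : x < rho by rewrite gtr_pMr // gtrBl.
have bDx : pbounded D x by apply: pbounded_D_le => //; lra.
have btx : pbounded t x by exact: pbounded_tser_lt.
have e := tree_like_pval (tree_like_tser R) x0 bDx btx.
have y1 := pval_tser_lt x0 xr.
have y0 : 0 <= pval t x by apply: le_trans (psum_le_pval 0 btx); rewrite /psum big_ord0.
have g0 : 0 <= gap u by rewrite subr_ge0.
have g1 : gap u <= 1 by rewrite /gap gerBl.
have hE : (1 - gap u) * expR (gap u) = expR 1 * (x * pval D x).
  rewrite /gap subKr -/x expRB [X in X * _]e.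
  move: (expR (pval t x)) (expR_gt0 (pval t x)) => E E0.
  by field; rewrite gt_eqF.
have hphi : expR 1 * (rho * Y) = 1.
  by rewrite radius_pval_D -expRD subrr expR0.
have Dx1 : 1 <= pval D x by apply: pval_D_ge1 => //; lra.
have DxY : pval D x <= Y by apply: pval_le_arg (@D_coef_ge0 R) x0 (ltW xr) bD.
have hc : Y <= pval D x + u * D_slope R.
  apply: pval_le => N.
  apply: le_trans (psum_convex N (@D_coef_ge0 R) x0 (ltW xr) (ltW rq) _) _.
    by lra.
  apply: lerD; first exact: psum_le_pval.
  have -> : rho - x = u * rho by rewrite /x; ring.
  rewrite /D_slope -!mulrA; apply: ler_wpM2l; first exact: ltW.
  apply: ler_wpM2l; first exact: ltW.
  rewrite mulrC; apply: ler_pM.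
  - by apply: psum_ge0; [exact: D_coef_ge0|lra].
  - by rewrite invr_ge0; lra.
  - exact/psum_le_pval/pbounded_D_sqrt_radius.
  - by rewrite lef_pV2 ?posrE; lra.
have /andP[q1 q2] := quadratic_expR g0 g1.
rewrite hE in q1 q2.
have lo : expR 1 * rho * u <= 1 - expR 1 * (x * pval D x).
  rewrite -[X in X - _]hphi -mulrBr -mulrA; apply: ler_wpM2l; first exact: ltW.
  rewrite /x -mulrA -mulrBr; apply: ler_wpM2l; first exact: ltW.
  have : 0 <= (1 - u) * (Y - pval D x) by rewrite mulr_ge0 // subr_ge0.
  have : u * 1 <= u * Y by rewrite ler_wpM2l // ltW.
  by lra.
have hi : 1 - expR 1 * (x * pval D x) <= expR 1 * c * u.
  rewrite -[X in X - _]hphi -mulrBr -mulrA; apply: ler_wpM2l; first exact: ltW.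
  rewrite /x cE -!mulrA -mulrBr; apply: ler_wpM2l; first exact: ltW.
  have : u * pval D x <= u * Y by rewrite ler_wpM2l // ltW.
  by lra.
apply/andP; split.
  rewrite -sqrtrM; last by rewrite mulr_ge0 // ltW.
  rewrite -[leRHS](ger0_norm g0) -sqrtr_sqr ler_sqrt ?exprn_ge0 //.
  exact: le_trans lo q2.
rewrite -sqrtrM; last by rewrite !mulr_ge0 // ltW.
rewrite -[leLHS](ger0_norm g0) -sqrtr_sqr ler_sqrt; last first.
  by rewrite !mulr_ge0 // ltW.
by lra.
Qed.

Lemma one_sub_exp_ge (u : R) n : 0 <= u <= 1 ->
  n%:R * u <= (1 - (1 - u) ^+ n) * (1 + n%:R * u).
Proof. by move=> hu; have := bernoulli_le n hu; lra. Qed.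

Lemma sum_indic N Z : \sum_(i < N) ((i <= Z)%N%:R : R) <= Z.+1%:R.
Proof.
suff -> : \sum_(i < N) ((i <= Z)%N%:R : R) = (minn N Z.+1)%:R by rewrite ler_nat geq_minr.
elim: N => [|N IH]; first by rewrite big_ord0 min0n.
rewrite big_ord_recr IH /= -natrD; congr (_%:R); case: leqP; lia.
Qed.

(** A Tauberian argument at the scales [v = 1 / Y], [uX = v / K] and [uZ = v / K^2]. If all terms of
    the window were small, [gap uX], of order [sqrt v / kk] with [K = kk^2], would come from
    [n < Y], where it is at most [(2 / K) gap v], and from [n > K^2 Y], where it is at most
    [2 gap uZ]. Both are of order [sqrt v / K], too small for large [kk]. *)
Lemma window : exists (L : nat) (c : R), [/\ (0 < L)%N, 0 < c &
  forall Y : nat, (0 < Y)%N -> exists n : nat,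
    (Y <= n <= L * Y)%N /\ c <= t n * rho ^+ n * Y%:R ^+ 2].
Proof.
have [b1 [b2 [b10 b20 hb]]] := gap_bounds; have rho0 := @radius_gt0 R.
(* In the final comparison with [b1 sqrt v / (2 kk)], this choice makes the two outer ranges less
   than half of it, and [eta] below makes the window at most the other half. *)
have [k hk] : exists k : nat, 16 * b2 / b1 < k.+1%:R.
  by eexists; exact: truncnS_gt.
rewrite ltr_pdivrMr // in hk.
set kk : R := k.+1%:R in hk; have kk1 : 1 <= kk by rewrite ler1n.
have [eta etaE] : exists eta : R, eta = b1 / (8 * kk) by eexists.
have eta0 : 0 < eta by rewrite etaE divr_gt0 // mulr_gt0 //; lra.
pose K : R := kk ^+ 2; have K1 : 1 <= K by rewrite exprn_ege1.
exists (k.+1 ^ 4)%N, (eta / K ^+ 2); split.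
- by rewrite expn_gt0.
- by rewrite divr_gt0 // exprn_gt0 //; lra.
move=> Y Y0; apply: contrapT => /forallNP H.
have YR : 1 <= Y%:R :> R by rewrite ler1n.
pose v : R := Y%:R^-1.
have v0 : 0 < v by rewrite invr_gt0; lra.
have v1 : v <= 1 by rewrite invf_le1 //; lra.
have Yv : Y%:R * v = 1 by rewrite mulfV // gt_eqF //; lra.
have [Z ZE] : exists Z : nat, Z = (k.+1 ^ 4 * Y)%N by eexists.
have Zpos : (0 < Z)%N by rewrite ZE muln_gt0 expn_gt0 Y0.
have ZR : Z%:R = K ^+ 2 * Y%:R :> R by rewrite ZE natrM natrX -exprM.
have Ki0 : 0 < K^-1 by rewrite invr_gt0; lra.
have Ki1 : K^-1 <= 1 by rewrite invf_le1 //; lra.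
have KKi : K * K^-1 = 1 by rewrite mulfV // gt_eqF //; lra.
pose uX := v * K^-1; pose uZ := v * K^-1 * K^-1.
have uX0 : 0 < uX by rewrite mulr_gt0.
have uZ0 : 0 < uZ by rewrite mulr_gt0.
have uX1 : uX <= 1 by rewrite mulr_ile1 // ltW.
have uZ1 : uZ <= 1 by rewrite mulr_ile1 // ltW.
have K0 : 0 <= K by lra.
have aE : 0 <= eta / K ^+ 2 * v ^+ 2.
  apply: mulr_ge0; first by apply: divr_ge0; [exact: ltW|exact: exprn_ge0].
  by apply: exprn_ge0; exact: ltW.
(* Three ranges: [n v <= 1] linearizes the term below the window, [n uZ >= 1] makes [1 - (1 - uZ)^n]
   at least [1/2] above it, and inside it the assumed smallness of [t n * rho ^+ n] is used. *)
have ptw n : t n * rho ^+ n * (1 - (1 - uX) ^+ n) <=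
    2 * K^-1 * (t n * rho ^+ n * (1 - (1 - v) ^+ n)) +
    2 * (t n * rho ^+ n * (1 - (1 - uZ) ^+ n)) +
    eta / K ^+ 2 * v ^+ 2 * (n <= Z)%N%:R.
  set a := t n * rho ^+ n.
  have a0 : 0 <= a by rewrite mulr_ge0 ?tser_ge0 ?exprn_ge0 // ltW.
  have B (u : R) : 0 < u -> u <= 1 -> 0 <= 1 - (1 - u) ^+ n <= 1.
    move=> h0 h1; rewrite gerBl subr_ge0 exprn_ile1 ?exprn_ge0 //; lra.
  have /andP[X0 X1] := B _ uX0 uX1.
  have /andP[W0 _] := B _ v0 v1.
  have /andP[Z0 _] := B _ uZ0 uZ1.
  have aX := mulr_ge0 a0 X0; have aZ := mulr_ge0 a0 Z0.
  have aV := mulr_ge0 (ltW Ki0) (mulr_ge0 a0 W0).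
  case: (ltnP n Y) => nY.
    have hv := @one_sub_exp_ge v n; rewrite (ltW v0) v1 in hv; move/(_ isT) in hv.
    have nv : n%:R * v <= 1 by rewrite -[leRHS]Yv ler_wpM2r ?ler_nat ?(ltW v0) ?(ltnW nY).
    have hx := @bernoulli_ge R uX n; rewrite (ltW uX0) uX1 in hx; move/(_ isT) in hx.
    have h1 : 1 - (1 - uX) ^+ n <= 2 * K^-1 * (1 - (1 - v) ^+ n).
      apply: (@le_trans _ _ (n%:R * uX)); first by lra.
      have hh : n%:R * v <= 2 * (1 - (1 - v) ^+ n).
        have : (1 - (1 - v) ^+ n) * (1 + n%:R * v) <= (1 - (1 - v) ^+ n) * 2.
          by rewrite ler_wpM2l //; lra.
        by lra.
      by have := ler_wpM2l (ltW Ki0) hh; rewrite /uX; lra.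
    have h2 := ler_wpM2l a0 h1.
    have h3 : 0 <= eta / K ^+ 2 * v ^+ 2 * (n <= Z)%N%:R by rewrite mulr_ge0.
    have -> : 2 * K^-1 * (a * (1 - (1 - v) ^+ n)) = a * (2 * K^-1 * (1 - (1 - v) ^+ n)) by ring.
    by lra.
  case: (leqP n Z) => nZ; rewrite ?mulr1 ?mulr0.
    have : a < eta / K ^+ 2 * v ^+ 2.
      rewrite ltNge; apply/negP => h; apply: (H n); split; first by rewrite nY -ZE.
      have := ler_wpM2r (exprn_ge0 2 (ler0n R Y)) h.
      have -> : eta / K ^+ 2 * v ^+ 2 * Y%:R ^+ 2 = eta / K ^+ 2 * (Y%:R * v) ^+ 2.
        by ring.
      by rewrite Yv expr1n mulr1.
    have : a * (1 - (1 - uX) ^+ n) <= a * 1 by rewrite ler_wpM2l.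
    by lra.
  have hz := @one_sub_exp_ge uZ n; rewrite (ltW uZ0) uZ1 in hz; move/(_ isT) in hz.
  have nz : 1 <= n%:R * uZ.
    have ZuZ : Z%:R * uZ = 1.
      rewrite ZR /uZ (_ : _ * _ = (K * K^-1) ^+ 2 * (Y%:R * v)); last by ring.
      by rewrite KKi Yv expr1n mulr1.
    by rewrite -[leLHS]ZuZ ler_wpM2r ?ler_nat ?(ltW uZ0) ?(ltnW nZ).
  have h1 : 1 / 2 <= 1 - (1 - uZ) ^+ n.
    have n0 : 0 < 1 + n%:R * uZ by lra.
    by rewrite -(ler_pM2r n0); lra.
  have : a * (1 - (1 - uX) ^+ n) <= a * 1 by rewrite ler_wpM2l.
  have := ler_wpM2l a0 h1.
  by lra.
have hX := hb uX; rewrite uX0 uX1 in hX; move/(_ isT) in hX.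
have hV := hb v; rewrite v0 v1 in hV; move/(_ isT) in hV.
have hZ := hb uZ; rewrite uZ0 uZ1 in hZ; move/(_ isT) in hZ.
set w := Num.sqrt v in hV; have w0 : 0 < w by rewrite sqrtr_gt0.
have sK : Num.sqrt K^-1 = kk^-1.
  by rewrite /K -exprVn sqrtr_sqr ger0_norm // invr_ge0; lra.
have sX : Num.sqrt uX = w * kk^-1 by rewrite sqrtrM ?sK // ltW.
have sZ : Num.sqrt uZ = w * K^-1.
  rewrite sqrtrM; last by rewrite mulr_ge0 // ltW.
  by rewrite -/uX sX sK -mulrA -expr2 exprVn.
rewrite sX in hX; rewrite sZ in hZ.
move: hX hV hZ => /andP[hX _] /andP[_ hV] /andP[_ hZ].
have ki0 : 0 < kk^-1 by rewrite invr_gt0; lra.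
have gX0 : 0 < gap uX by apply: lt_le_trans hX; rewrite !mulr_gt0.
have [N hN] : exists N, gap uX / 2 <= gap_sum uX N.
  by apply: gap_sum_ge => //; rewrite uX0.
have S : gap_sum uX N <= 2 * K^-1 * gap_sum v N + 2 * gap_sum uZ N +
    eta / K ^+ 2 * v ^+ 2 * Z.+1%:R.
  apply: (@le_trans _ _ (2 * K^-1 * gap_sum v N + 2 * gap_sum uZ N +
      eta / K ^+ 2 * v ^+ 2 * \sum_(i < N) (i <= Z)%N%:R)).
    rewrite /gap_sum !mulr_sumr -!big_split /=; apply: ler_sum => n _; exact: ptw.
  rewrite lerD2l; apply: ler_wpM2l; last exact: sum_indic.
  exact: aE.
have GV : gap_sum v N <= b2 * w.
  by apply: le_trans hV; apply: gap_sum_le; rewrite v0.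
have GZ : gap_sum uZ N <= b2 * (w * K^-1).
  by apply: le_trans hZ; apply: gap_sum_le; rewrite uZ0.
have vw : v <= w.
  by rewrite -{1}[v]sqr_sqrtr ?(ltW v0) // expr2 ler_piMl ?(ltW w0) // -sqrtr1 ler_sqrt.
have E : eta / K ^+ 2 * v ^+ 2 * Z.+1%:R <= 2 * eta * w.
  apply: (@le_trans _ _ (eta / K ^+ 2 * v ^+ 2 * (2 * Z%:R))).
    apply: ler_wpM2l; first exact: aE.
    by rewrite -natrM ler_nat mul2n -addnn -addn1 leq_add2l.
  have -> : eta / K ^+ 2 * v ^+ 2 * (2 * Z%:R) = 2 * eta * v.
    rewrite ZR -exprVn (_ : _ * _ = 2 * eta * ((K * K^-1) ^+ 2) * v * (Y%:R * v)).
      by rewrite KKi Yv expr1n !mulr1.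
    by ring.
  by rewrite ler_wpM2l //; lra.
have T1 : K^-1 * gap_sum v N <= K^-1 * (b2 * w) by rewrite ler_wpM2l // ltW.
have fin : b1 * (w * kk^-1) / 2 <= 4 * K^-1 * b2 * w + 2 * eta * w.
  move: hX hN S GZ E T1.
  move: (gap uX) (gap_sum uX N) (gap_sum v N) (gap_sum uZ N)
    (eta / K ^+ 2 * v ^+ 2 * Z.+1%:R) K^-1.
  move: (w / kk) => wk i1 i2 i3 i4 i5 i6 h1 h2 h3 h4 h5 h6.
  have h7 : 2 * i6 * i3 <= 2 * (i6 * (b2 * w)) by rewrite -mulrA ler_pM2l.
  by lra.
have Kk : K^-1 = kk^-1 * kk^-1 by rewrite -exprVn expr2.
have kki : kk * kk^-1 = 1 by rewrite mulfV // gt_eqF //; lra.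
have eE : eta = b1 * kk^-1 / 8 by rewrite etaE; field; rewrite gt_eqF //; lra.
rewrite Kk eE in fin.
have : 16 * b2 * (kk^-1 * kk^-1 * w) < b1 * kk * (kk^-1 * kk^-1 * w).
  by rewrite ltr_pM2r ?mulr_gt0 //; lra.
have -> : b1 * kk * (kk^-1 * kk^-1 * w) = b1 * kk^-1 * w * (kk * kk^-1) by ring.
rewrite kki mulr1; move: fin.
have -> : b1 * (w / kk) / 2 = b1 * kk^-1 * w / 2 by ring.
have -> : 4 * (kk^-1 * kk^-1) * b2 * w + 2 * (b1 / kk / 8) * w =
  4 * (b2 * (kk^-1 * kk^-1 * w)) + b1 * kk^-1 * w / 4.
  by move: kk^-1 => i; field.
rewrite -(mulrA 16); move: (b2 * (kk^-1 * kk^-1 * w)) (b1 / kk * w) => Q P.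
by lra.
Qed.

(* Cutting off repeatedly a subtree whose size lies in a window proportional to
   [n] takes [O(log n)] steps. *)
Lemma tser_lower : exists A : R, 0 <= A /\ forall n : nat, (0 < n)%N ->
  expR (- (A * (1 + ln n%:R) ^+ 2)) <= t n * rho ^+ n.
Proof.
have [L [c [L0 c0 hw]]] := window; have rho0 := @radius_gt0 R; have rho1 := @radius_lt1 R.
have LR : 1 <= L%:R :> R by rewrite ler1n.
pose kap : R := (4 * L%:R)^-1.
have kap0 : 0 < kap by rewrite invr_gt0; lra.
have kap1 : kap <= 1 / 4.
  by rewrite /kap invfM mul1r ler_piMr ?invr_ge0 // invf_le1 //; lra.
pose C := Num.max 0 (- ln (rho * c / 2)).
have C0 : 0 <= C by rewrite le_max lexx.
have hC : expR (- C) <= rho * c / 2.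
  rewrite -[leRHS]lnK; last by rewrite posrE divr_gt0 ?mulr_gt0.
  by rewrite ler_expR lerNl le_max lexx orbT.
have lnrho : ln rho < 0 by rewrite ln_lt0 // rho0.
(* The first summand pays for one cut: it loses at most [exp (- C - 2 lam)], while [A (lam^2 - (lam
   - kap)^2) >= A kap lam >= (C + 2) lam]. The second covers [n < 4 L], where [t_n >= 1]
   suffices. *)
pose A := (C + 2) / kap + (4 * L)%:R * - ln rho.
have A1 : 0 <= (C + 2) / kap by rewrite divr_ge0 ?(ltW kap0) //; lra.
have A2 : 0 <= (4 * L)%:R * - ln rho by rewrite mulr_ge0 //; lra.
have A0 : 0 <= A by rewrite addr_ge0.
exists A; split => //; elim/ltn_ind => n IH n0.
have nR : 1 <= n%:R :> R by rewrite ler1n.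
have ln0 : 0 <= ln n%:R :> R by exact: ln_ge0.
set lam := 1 + ln n%:R; have lam1 : 1 <= lam by rewrite /lam; lra.
case: (ltnP n (4 * L)) => nL.
  apply: (@le_trans _ _ (rho ^+ n)); last first.
    rewrite ler_peMl ?exprn_ge0 ?(ltW rho0) //.
    by case: n n0 {IH nR ln0 lam lam1 nL} => // n _; exact: tser_ge1.
  have -> : rho ^+ n = expR (n%:R * ln rho) by rewrite expRM_natl lnK.
  rewrite ler_expR lerNl -mulrN.
  have h1 : n%:R * - ln rho <= (4 * L)%:R * - ln rho.
    by rewrite ler_wpM2r ?ler_nat ?(ltnW nL) //; lra.
  apply: le_trans h1 _; apply: (@le_trans _ _ A); first by rewrite /A; lra.
  by rewrite ler_peMr // exprn_ege1.
have L2 : (0 < 2 * L)%N by rewrite muln_gt0.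
(* With this [Y] the window [[Y, L Y]] lies below [n / 2], and [Y >= n / (4 L)], so that the
   remaining size [p] is at most [n (1 - kap)]. *)
have [Y YE] : exists Y : nat, Y = (n %/ (2 * L))%N by eexists.
have Y2 : (2 <= Y)%N by rewrite YE leq_divRL // mulnA.
have YL : (Y * (2 * L) <= n)%N by rewrite YE leq_trunc_div.
have nY : (n < Y.+1 * (2 * L))%N by rewrite YE ltn_ceil.
have Y0 : (0 < Y)%N by exact: ltnW.
have [m [/andP[Ym mY] hm]] := hw Y Y0.
have nat_facts : [/\ (2 * m <= n)%N, (0 < m)%N, (m.+2 <= n)%N &
    (4 * L * (n - m.+1) + n <= 4 * L * n)%N].
  clear -L0 Y2 YL nY Ym mY; split; [nia|lia|nia|].
  have h1 : (n <= 4 * L * Y)%N by nia.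
  have h2 : (n - m.+1 + Y <= n)%N by nia.
  nia.
have [m2 m0 mn hLp] := nat_facts.
have [p pE'] : exists p : nat, p = (n - m.+1)%N by eexists.
have [pE p0 pn] : [/\ n = (m + p).+1, (0 < p)%N & (p < n)%N].
  by clear -pE' mn; split; lia.
have pR : 1 <= p%:R :> R by rewrite ler1n.
have hp : p%:R <= n%:R * (1 - kap).
  have hR : 4 * L%:R * p%:R + n%:R <= 4 * L%:R * n%:R :> R.
    by rewrite -!natrM -natrD ler_nat pE'.
  have L4 : 0 < 4 * L%:R :> R by lra.
  rewrite -(ler_pM2l L4) mulrBr mulr1 mulrBr (mulrCA _ n%:R) /kap mulfV ?gt_eqF // mulr1.
  by lra.
have lp : 1 + ln p%:R <= lam - kap.
  have : ln p%:R <= ln (n%:R * (1 - kap)).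
    rewrite ler_ln ?posrE ?mulr_gt0 //; first (by clear -pR; lra).
      by clear -nR; lra.
    by clear -kap1; lra.
  rewrite lnM ?posrE; [|lra|lra].
  have := @le_ln1Dx R (- kap); rewrite /lam; lra.
have lp0 : 0 <= ln p%:R :> R by exact: ln_ge0.
have IHp := IH p pn p0.
have sq : (1 + ln p%:R) ^+ 2 <= (lam - kap) ^+ 2.
  by rewrite ler_sqr ?nnegrE //; lra.
have e1 : expR (- (A * (lam - kap) ^+ 2)) <= t p * rho ^+ p.
  by apply: le_trans IHp; rewrite ler_expR lerN2 ler_wpM2l.
have e2 : c * expR (- (2 * lam)) <= t m * rho ^+ m.
  have n2 : expR (- (2 * lam)) <= (n%:R ^+ 2)^-1.
    rewrite expRN lef_pV2 ?posrE ?expR_gt0 ?exprn_gt0 //; last lra.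
    have -> : n%:R ^+ 2 = expR (2 * ln n%:R) :> R.
      by rewrite mulr_natl mulr2n expRD lnK ?expr2 // posrE; lra.
    by rewrite ler_expR /lam; lra.
  apply: (@le_trans _ _ (c * (n%:R ^+ 2)^-1)); first by rewrite ler_wpM2l // ltW.
  rewrite ler_pdivrMr ?exprn_gt0 //; last lra.
  apply: le_trans hm _; rewrite ler_wpM2l //.
    by rewrite mulr_ge0 ?tser_ge0 ?exprn_ge0 // ltW.
  by rewrite ler_sqr ?nnegrE ?ler_nat ?ler0n // YE leq_div.
have e3 : (t m * rho ^+ m) * (t p * rho ^+ p) * (rho / 2) <= t n * rho ^+ n.
  have -> : (t m * rho ^+ m) * (t p * rho ^+ p) * (rho / 2) =
    (t m * t p / 2) * rho ^+ n by rewrite pE exprS exprD; ring.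
  apply: ler_wpM2r; first by rewrite exprn_ge0 // ltW.
  by rewrite [in leRHS]pE; exact: tser_join.
apply: le_trans e3.
apply: (@le_trans _ _ (c * expR (- (2 * lam)) * expR (- (A * (lam - kap) ^+ 2)) * (rho / 2))).
  have -> : c * expR (- (2 * lam)) * expR (- (A * (lam - kap) ^+ 2)) * (rho / 2) =
    (rho * c / 2) * expR (- (2 * lam) - A * (lam - kap) ^+ 2) by rewrite expRD; ring.
  apply: (@le_trans _ _ (expR (- C) * expR (- (2 * lam) - A * (lam - kap) ^+ 2))).
    rewrite -expRD ler_expR.
    have hA : (C + 2) * lam <= A * kap * lam.
      rewrite ler_wpM2r //; first lra.
      rewrite -ler_pdivrMr // /A; lra.
    have h2 : A * kap * kap <= A * kap * lam.
      by apply: ler_wpM2l; [rewrite mulr_ge0 // ltW|lra].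
    have h3 : C * 1 <= C * lam by rewrite ler_wpM2l.
    by lra.
  by rewrite ler_wpM2r ?expR_ge0.
apply: ler_wpM2r; first by rewrite divr_ge0 // ltW.
by apply: ler_pM => //; rewrite ?mulr_ge0 ?expR_ge0 // ltW.
Qed.

End TreeCountLowerBound.

(** * Tail estimates *)

Section Tails.
Variable R : realType.
Local Notation D := (D_coef R).
Local Notation t := (tser R).
Local Notation rho := (polya_radius R).
Local Notation q := (sqrt_radius R).

(** With [z] the fourth root of [x], [ln x = 4 ln z <= 4 z] gives [(1 + ln x)^2 <= 25 sqrt x]; the
    constant then completes a square in [sqrt x]. *)
Lemma log_sq_le (A b : R) : 0 <= A -> 0 < b ->
  exists C : R, 0 <= C /\ forall x : R, 1 <= x -> A * (1 + ln x) ^+ 2 <= b * x + C.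
Proof.
move=> A0 b0; exists ((25 * A) ^+ 2 / (4 * b)); split.
  by rewrite divr_ge0 ?sqr_ge0 // mulr_ge0 ?(ltW b0).
move=> x x1; have x0 : 0 < x by lra.
pose y := Num.sqrt x; pose z := Num.sqrt y.
have y1 : 1 <= y by rewrite /y -[leLHS]sqrtr1 ler_sqrt // ltW.
have z1 : 1 <= z by rewrite /z -[leLHS]sqrtr1 ler_sqrt //; lra.
have yx : y ^+ 2 = x by rewrite sqr_sqrtr // ltW.
have zy : z ^+ 2 = y by rewrite sqr_sqrtr //; lra.
have l0 : 0 <= ln x by exact: ln_ge0.
have lz : ln x <= 4 * z.
  have z0 : 0 < z by lra.
  have y0 : 0 < y by lra.
  have -> : ln x = 4 * ln z by rewrite -yx lnXn // -zy lnXn //; ring.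
  by rewrite ler_pM2l //; exact/ltW/ln_sublinear.
have h : (1 + ln x) ^+ 2 <= 25 * y.
  apply: (@le_trans _ _ ((5 * z) ^+ 2)).
    by rewrite ler_sqr ?nnegrE //; lra.
  by rewrite exprMn zy; lra.
apply: le_trans (ler_wpM2l A0 h) _.
rewrite -subr_ge0 -yx.
have -> : b * y ^+ 2 + (25 * A) ^+ 2 / (4 * b) - A * (25 * y) =
  (2 * b * y - 25 * A) ^+ 2 / (4 * b) by field; rewrite gt_eqF.
apply: divr_ge0; first exact: sqr_ge0.
by rewrite mulr_ge0 // ltW.
Qed.

Lemma geometric_le (p : R) N : 0 <= p -> p < 1 -> \sum_(i < N) p ^+ i <= (1 - p)^-1.
Proof.
move=> p0 p1; have h : 0 < 1 - p by lra.
rewrite -(ler_pM2l h) mulfV ?gt_eqF //.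
have := subrX1 p N; have : 0 <= p ^+ N by exact: exprn_ge0.
by lra.
Qed.

(** Write [i = M + j] and [q^j = p^j p^j] with [p = sqrt q]: one factor absorbs the logarithmic
    growth in [j], the other is summed. The exponent [2 A] comes from
    [(u + v)^2 <= 2 u^2 + 2 v^2]. *)
Lemma log_tail_sum (A : R) : 0 <= A -> exists C : R, 0 <= C /\ forall M N, (0 < M)%N ->
  \sum_(M <= i < N) q ^+ i * expR (A * (1 + ln i%:R) ^+ 2) <=
  C * (q ^+ M * expR (2 * A * (1 + ln M%:R) ^+ 2)).
Proof.
move=> A0; have q0 := @sqrt_radius_gt0 R; have q1 := @sqrt_radius_lt1 R.
pose p := Num.sqrt q; have p0 : 0 < p by rewrite sqrtr_gt0.
have pq : p ^+ 2 = q by rewrite sqr_sqrtr // ltW.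
have p1 : p < 1 by rewrite -sqrtr1 ltr_sqrt.
have lp : 0 < - ln p by rewrite oppr_gt0 ln_lt0 // p0.
have A20 : 0 <= 2 * A by rewrite mulr_ge0.
have [C [C0 hC]] := log_sq_le A20 lp.
exists (expR (C - ln p) * (1 - p)^-1); split.
  by rewrite mulr_ge0 ?expR_ge0 // invr_ge0; lra.
move=> M N M0; set QM := q ^+ M * _.
have QM0 : 0 <= QM by rewrite mulr_ge0 ?expR_ge0 ?exprn_ge0 // ltW.
have MR : 1 <= M%:R :> R by rewrite ler1n.
have term j : q ^+ (j + M) * expR (A * (1 + ln (j + M)%:R) ^+ 2) <=
    expR (C - ln p) * p ^+ j * QM.
  have jR : 1 <= j.+1%:R :> R by rewrite ler1n.
  have l1 : 0 <= ln M%:R :> R by exact: ln_ge0.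
  have l2 : 0 <= ln j.+1%:R :> R by exact: ln_ge0.
  have l3 : 0 <= ln (j + M)%:R :> R by rewrite ln_ge0 // ler1n addn_gt0 M0 orbT.
  have hl : ln (j + M)%:R <= ln M%:R + ln j.+1%:R :> R.
    rewrite -lnM ?posrE; [|lra|lra].
    rewrite ler_ln ?posrE ?mulr_gt0 ?ltr0n ?addn_gt0 ?M0 ?orbT //.
    by rewrite -natrM ler_nat mulnS addnC leq_add2l leq_pmull.
  have hsq : (1 + ln (j + M)%:R) ^+ 2 <=
      2 * (1 + ln M%:R) ^+ 2 + 2 * (1 + ln j.+1%:R) ^+ 2 :> R.
    apply: (@le_trans _ _ ((1 + ln M%:R + (1 + ln j.+1%:R)) ^+ 2)).
      by rewrite ler_sqr ?nnegrE; lra.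
    rewrite -subr_ge0; set u := 1 + ln M%:R; set v := 1 + ln j.+1%:R.
    have -> : 2 * u ^+ 2 + 2 * v ^+ 2 - (u + v) ^+ 2 = (u - v) ^+ 2 by ring.
    exact: sqr_ge0.
  have hj := hC _ jR.
  have hA := ler_wpM2l A0 hsq.
  have hq : q ^+ j = p ^+ j * p ^+ j by rewrite -pq -exprM mulnC exprM expr2.
  have pj : p ^+ j = expR (j%:R * ln p) by rewrite expRM_natl lnK.
  have e1 : expR (A * (1 + ln (j + M)%:R) ^+ 2) <=
      expR (2 * A * (1 + ln M%:R) ^+ 2) * (expR (C - ln p) * expR (- (j%:R * ln p))).
    rewrite -!expRD ler_expR.
    move: hj; rewrite -natr1; lra.
  rewrite exprD hq; apply: le_trans (ler_wpM2l _ e1) _.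
    by rewrite !mulr_ge0 ?exprn_ge0 // ltW.
  have -> : p ^+ j * p ^+ j * q ^+ M * (expR (2 * A * (1 + ln M%:R) ^+ 2) *
      (expR (C - ln p) * expR (- (j%:R * ln p)))) =
    expR (C - ln p) * p ^+ j * QM * (p ^+ j * expR (- (j%:R * ln p))).
    by rewrite /QM; ring.
  by rewrite {2}pj -expRD subrr expR0 mulr1.
case: (leqP N M) => NM.
  by rewrite big_geq // mulr_ge0 // mulr_ge0 ?expR_ge0 // invr_ge0; lra.
rewrite -{1}[M]add0n big_addn big_mkord.
apply: (@le_trans _ _ (\sum_(i < N - M) expR (C - ln p) * p ^+ i * QM)).
  by apply: ler_sum => i _; exact: term.
rewrite -mulr_suml -mulr_sumr; apply: ler_wpM2r => //.
by apply: ler_wpM2l; [exact: expR_ge0|apply: geometric_le => //; exact: ltW].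
Qed.

Lemma upper_tail (A : R) : 0 <= A ->
  (forall n : nat, (0 < n)%N -> expR (- (A * (1 + ln n%:R) ^+ 2)) <= t n * rho ^+ n) ->
  exists C : R, 0 <= C /\ forall M n, (1 < M)%N -> (0 < n)%N ->
    excess R M n / t n <=
    C * (n%:R * (q ^+ M * expR (2 * A * (1 + ln M%:R) ^+ 2))).
Proof.
move=> A0 hA; have q0 := @sqrt_radius_gt0 R; have rho0 := @radius_gt0 R.
have [C [C0 hC]] := log_tail_sum A0.
set CD := pval D q.
have CD0 : 0 <= CD by apply: le_trans ler01 (pval_D_ge1 (ltW q0) (lexx _)).
have c20 : 0 <= 2 * CD / rho by rewrite divr_ge0 ?mulr_ge0 // ltW.
exists (2 * CD / rho * C); split; first by rewrite mulr_ge0.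
move=> M n M1 n0.
have tn0 : 0 < t n by case: n n0 => // n _; exact: tser_gt0.
have term i : (M <= i < n)%N ->
    tailD R M i * theta R (n - i) <=
    2 * CD / rho * n%:R * t n * (q ^+ i * expR (A * (1 + ln i%:R) ^+ 2)).
  move=> /andP[Mi ni].
  have hD : D i * q ^+ i <= CD.
    apply: le_trans (psum_le_pval i.+1 (@pbounded_D_sqrt_radius R)).
    by rewrite psumS lerDr psum_ge0 ?(ltW q0) //; exact: D_coef_ge0.
  have tl : tailD R M i <= D i by rewrite /tailD gerBl cutoff_ge0.
  have th : theta R (n - i) <= n%:R * t (n - i)%N.
    by rewrite /theta ler_wpM2r ?tser_ge0 // ler_nat leq_subr.
  have th0 : 0 <= theta R (n - i) by rewrite mulr_ge0 ?tser_ge0.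
  have i1 : (0 < i.-1)%N by clear -M1 Mi; lia.
  have i0 : (0 < i)%N by exact: ltnW (leq_trans M1 Mi).
  (* Joining with a tree of size [i - 1] bounds [t_(n - i) / t_n] by [rho^i] up to the loss at size
     [i]; against [d_i <= CD q^(- i)] this leaves [q^i]. The hypothesis [1 < M] makes [i - 1]
     positive. *)
  have join := tser_join R i.-1 (n - i).
  rewrite (_ : (i.-1 + (n - i)).+1 = n) in join; last by clear -i1 ni; lia.
  have low : expR (- (A * (1 + ln i%:R) ^+ 2)) * rho <= t i.-1 * rho ^+ i.
    have -> : rho ^+ i = rho ^+ i.-1 * rho by rewrite -exprSr prednK.
    rewrite mulrA ler_wpM2r ?(ltW rho0) //.
    apply: le_trans (hA i.-1 i1); rewrite ler_expR lerN2 ler_wpM2l //.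
    have ip : 1 <= i.-1%:R :> R by rewrite ler1n.
    have il : i.-1%:R <= i%:R :> R by rewrite ler_nat leq_pred.
    have := ln_ge0 ip.
    have : ln i.-1%:R <= ln i%:R :> R by rewrite ler_ln ?posrE //; lra.
    by move=> ? ?; rewrite ler_sqr ?nnegrE; lra.
  set E := expR _ in low *; set F := expR _.
  have EF : E * F = 1 by rewrite -expRD addrC subrr expR0.
  have F0 : 0 < F by exact: expR_gt0.
  have ti0 := tser_ge0 R (n - i).
  have r2 : q ^+ i * q ^+ i = rho ^+ i by rewrite -exprMn -expr2 sqrt_radius_sq.
  have key : t (n - i)%N * rho <= 2 * t n * rho ^+ i * F.
    have h1 := ler_wpM2r ti0 low.
    have h2 := ler_wpM2r (exprn_ge0 i (ltW rho0)) join.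
    have h3 : E * (t (n - i)%N * rho) <= 2 * t n * rho ^+ i by lra.
    have := ler_wpM2r (ltW F0) h3.
    have -> : E * (t (n - i)%N * rho) * F = E * F * (t (n - i)%N * rho) by ring.
    by rewrite EF mul1r.
  have qi0 : 0 < q ^+ i by exact: exprn_gt0.
  have hDt : D i * t (n - i)%N * rho <= 2 * CD * t n * (q ^+ i * F).
    have h1 := ler_wpM2l (D_coef_ge0 R i) key.
    apply: (@le_trans _ _ (D i * q ^+ i * (2 * t n * (q ^+ i * F)))).
      by rewrite -r2 in h1; lra.
    apply: le_trans (ler_wpM2r _ hD) _; last by lra.
    by rewrite !mulr_ge0 ?(ltW tn0) ?(ltW qi0) ?(ltW F0).
  apply: (@le_trans _ _ (D i * (n%:R * t (n - i)%N))).
    by apply: ler_pM => //; exact: tailD_ge0.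
  rewrite -(ler_pM2r rho0).
  have -> : 2 * CD / rho * n%:R * t n * (q ^+ i * F) * rho =
    n%:R * (2 * CD * t n * (q ^+ i * F)) by field; rewrite gt_eqF.
  have := ler_wpM2l (ler0n R n) hDt; lra.
rewrite ler_pdivrMr //; apply: le_trans (excess_le R M n) _.
apply: (@le_trans _ _ (\sum_(M <= i < n) tailD R M i * theta R (n - i))).
  rewrite /cprod big_ord_recr /= subnn /theta mul0r mulr0 addr0.
  rewrite -(big_mkord xpredT (fun i => tailD R M i * ((n - i)%:R * t (n - i)%N))).
  case: (leqP M n) => Mn.
    rewrite (big_cat_nat (n := M)) //= [X in X + _]big1_seq ?add0r //.
    move=> i /andP[_]; rewrite mem_index_iota => /andP[_ iM].
    by rewrite /tailD /cutoff iM subrr mul0r.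
  rewrite [leRHS]big_geq; last exact: ltnW.
  rewrite big1_seq // => i /andP[_]; rewrite mem_index_iota => /andP[_ iM].
  by rewrite /tailD /cutoff (ltn_trans iM Mn) subrr mul0r.
apply: le_trans (ler_sum_nat term) _; rewrite -mulr_sumr.
apply: le_trans (ler_wpM2l _ (hC M n (ltnW M1))) _.
  by apply: mulr_ge0 (ltW tn0); apply: mulr_ge0.
by rewrite le_eqVlt; apply/orP; left; apply/eqP; ring.
Qed.

Lemma lower_tail (A : R) : 0 <= A ->
  (forall n : nat, (0 < n)%N -> expR (- (A * (1 + ln n%:R) ^+ 2)) <= t n * rho ^+ n) ->
  exists c : R, 0 < c /\ forall h n, (0 < h)%N -> (0 < n)%N ->
    tree_sum (cutoff h.*2 D) n / t n <=
    expR (- (c * (n%:R * (q ^+ h.*2 * expR (- (A * (1 + ln h%:R) ^+ 2))))) +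
          A * (1 + ln n%:R) ^+ 2).
Proof.
move=> A0 hA; have q0 := @sqrt_radius_gt0 R; have rho0 := @radius_gt0 R.
have rq := @radius_lt_sqrt R; have K0 := @D_slope_gt0 R.
set K := D_slope R in K0.
set Y := pval D rho.
have bD : pbounded D rho by apply: pbounded_D_le; exact: ltW.
have Y1 : 1 <= Y by apply: pval_D_ge1; exact: ltW.
have KY : 0 < 2 * K + Y by lra.
exists ((4 * (2 * K + Y))^-1); split; first by rewrite invr_gt0 mulr_gt0.
move=> h n h0 n0; set M := h.*2.
have tn0 : 0 < t n by case: n n0 => // n _; exact: tser_gt0.
set E := expR (- (A * (1 + ln h%:R) ^+ 2)); have E0 : 0 < E by exact: expR_gt0.
(* The first coefficient removed by the cutoff already lowers [D(rho)] by [y]; this is the room in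
   which the radius can be increased. *)
have [y yE] : exists y : R, y = D M * rho ^+ M by eexists.
have y_lo : q ^+ M * E / 2 <= y.
  have h1 := hA h h0; rewrite -/E in h1.
  have rM : rho ^+ M = rho ^+ h * q ^+ M.
    have qh : q ^+ h * q ^+ h = rho ^+ h by rewrite -exprMn -expr2 sqrt_radius_sq.
    by rewrite /M -addnn !exprD qh.
  have h2 := ler_wpM2r (exprn_ge0 M (ltW rho0)) (D_coef_double R h0).
  have h3 := ler_wpM2r (exprn_ge0 M (ltW q0)) h1.
  by rewrite yE; apply: le_trans h2; rewrite rM; lra.
have qM0 : 0 < q ^+ M by exact: exprn_gt0.
have y0 : 0 < y by apply: lt_le_trans y_lo; rewrite divr_gt0 ?mulr_gt0.
have yY : y <= Y.
  rewrite yE; apply: le_trans (psum_le_pval M.+1 bD).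
  by rewrite psumS lerDr psum_ge0 ?(ltW rho0) //; exact: D_coef_ge0.
(* Chosen so that [(1 + d) (Y - y + d K) <= Y - y + d (2 K + Y) = Y], using [d <= 1]. *)
have [d dE] : exists d : R, d = y / (2 * K + Y) by eexists.
have d0 : 0 < d by rewrite dE divr_gt0.
have d1 : d <= 1 by rewrite dE ler_pdivrMr //; lra.
have dK : d * (2 * K + Y) = y by rewrite dE divfK // gt_eqF.
(* The choice of [d] suffices here: [2 d K <= Y] and [K (q - rho) = rho D(q) >= rho Y]. *)
have dq : rho * (1 + d) <= q.
  have YD : Y <= pval D q.
    apply: pval_le_arg; [exact: D_coef_ge0|exact: ltW|exact: ltW|].
    exact: pbounded_D_sqrt_radius.
  have KE : K * (q - rho) = rho * pval D q.
    by rewrite /K /D_slope divfK // subr_eq0 gt_eqF.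
  have h1 : d * (2 * K) <= Y.
    have : 0 <= d * Y by rewrite mulr_ge0 ?(ltW d0) //; lra.
    have := dK; lra.
  have h2 : d * rho * Y <= (q - rho) * Y.
    have qr : 0 < q - rho by lra.
    have h3 := ler_wpM2r (ltW qr) h1.
    have h4 : d * rho * Y <= d * rho * pval D q.
      by apply: ler_wpM2l => //; rewrite mulr_ge0 ?(ltW d0) ?(ltW rho0).
    have h5 : d * (2 * K) * (q - rho) = 2 * (d * rho * pval D q).
      have -> : d * (2 * K) * (q - rho) = 2 * d * (K * (q - rho)) by ring.
      by rewrite KE; ring.
    have h6 : 0 <= d * rho * pval D q.
      by rewrite !mulr_ge0 ?(ltW d0) ?(ltW rho0) //; lra.
    by lra.
  have Y0 : 0 < Y by lra.
  by rewrite ler_pM2r // in h2; lra.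
have cut N : psum (cutoff M D) rho N + y <= Y.
  apply: (@le_trans _ _ (psum (cutoff M D) rho (maxn N M.+1) + y)).
    by rewrite lerD2r psum_homo ?leq_maxl ?(ltW rho0) //; exact: cutoff_ge0.
  apply: le_trans (psum_le_pval (maxn N M.+1) bD).
  rewrite addrC -lerBrDr /psum -sumrB.
  have hM : (M < maxn N M.+1)%N by exact: leq_maxr.
  rewrite (bigD1 (Ordinal hM)) //= {1}/cutoff ltnn mul0r subr0 -yE lerDl.
  apply: sumr_ge0 => i _; rewrite -mulrBl mulr_ge0 ?exprn_ge0 ?(ltW rho0) //.
  by rewrite subr_ge0 cutoff_le.
have r0 : 0 < rho * (1 + d) by rewrite mulr_gt0 //; lra.
have small N : rho * (1 + d) * psum (cutoff M D) (rho * (1 + d)) N <= expR (-1).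
  have hp := psum_perturb N (@cutoff_ge0 R M) (@cutoff_le R M) (ltW d0) dq.
  rewrite -/K in hp; have hc := cut N.
  rewrite -radius_pval_D -/Y -mulrA ler_wpM2l ?(ltW rho0) //.
  apply: (@le_trans _ _ ((1 + d) * (Y - y + d * K))).
    by apply: ler_wpM2l; lra.
  have h1 : d * d * K <= d * K by rewrite ler_wpM2r ?(ltW K0) // ler_piMr // ltW.
  have h2 : 0 <= d * y by rewrite mulr_ge0 // ltW.
  move: dK; lra.
have le1 := tree_like_le1 (tree_like_tree_sum (@cutoff_ge0 R M)) (ltW r0) small n.+1.
have v0 i : 0 <= tree_sum (cutoff M D) i by apply: tree_sum_ge0; exact: cutoff_ge0.
have vn : tree_sum (cutoff M D) n * (rho * (1 + d)) ^+ n <= 1.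
  by apply: le_trans le1; rewrite psumS lerDr psum_ge0 // ltW.
set v := tree_sum (cutoff M D) n in vn *.
have hn := hA n n0.
set G := expR (A * (1 + ln n%:R) ^+ 2); have G0 : 0 < G by exact: expR_gt0.
rewrite expRN -/G in hn.
have hexp : expR (n%:R * (d / 2)) <= (1 + d) ^+ n.
  rewrite expRM_natl; apply: lerXn2r; rewrite ?nnegrE ?expR_ge0 //; first lra.
  have h1 := expR_ge1Dx (- (d / 2)); rewrite expRN in h1.
  have h2 : 0 < expR (d / 2) by exact: expR_gt0.
  have h3 := ler_wpM2r (ltW h2) h1.
  rewrite mulVf ?gt_eqF // in h3.
  have h4 : (1 - d / 2) * (1 + d) >= 1.
    have : 0 <= d * (1 - d) by rewrite mulr_ge0 ?(ltW d0) ?subr_ge0.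
    by lra.
  have h5 : 0 < 1 - d / 2 by lra.
  by rewrite -(ler_pM2l h5); lra.
have hd : (4 * (2 * K + Y))^-1 * (n%:R * (q ^+ M * E)) <= n%:R * (d / 2).
  rewrite mulrCA ler_wpM2l //.
  rewrite -(ler_pM2r KY); have -> : d / 2 * (2 * K + Y) = y / 2 by rewrite -dK; ring.
  have -> : (4 * (2 * K + Y))^-1 * (q ^+ M * E) * (2 * K + Y) = q ^+ M * E / 4.
    by field; rewrite gt_eqF.
  by lra.
set X := expR (n%:R * (d / 2)) in hexp.
have X0 : 0 < X by exact: expR_gt0.
rewrite expRD -/G expRN; set X' := expR (_^-1 * _).
have X'0 : 0 < X' by exact: expR_gt0.
have XX : X' <= X by rewrite ler_expR.
have rn0 : 0 < rho ^+ n by exact: exprn_gt0.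
have fin : v * X' <= G * t n.
  rewrite -(ler_pM2r rn0); apply: (@le_trans _ _ (v * (rho * (1 + d)) ^+ n)).
    rewrite exprMn -mulrA [X in _ <= _ * X]mulrC ler_wpM2l ?v0 // ler_wpM2r ?(ltW rn0) //.
    exact: le_trans XX hexp.
  apply: le_trans vn _; have := ler_wpM2l (ltW G0) hn.
  by rewrite mulfV ?gt_eqF // mulrA.
by rewrite ler_pdivrMr // -mulrA ler_pdivlMl // mulrC.
Qed.

End Tails.

(** * Concentration *)

Section Concentration.
Variable R : realType.
Local Notation D := (D_coef R).
Local Notation t := (tser R).
Local Notation rho := (polya_radius R).
Local Notation q := (sqrt_radius R).

Lemma nat_threshold_ge (a : R) : 0 <= a -> exists M : nat,
  M%:R <= a + 1 /\ forall m : nat, (a <= m%:R) = (M <= m)%N.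
Proof.
move=> a0; have ex : exists m : nat, a <= m%:R by eexists; exact/ltW/truncnS_gt.
case: (ex_minnP ex) => M hM min; exists M; split.
  case: M hM min => [|M] hM min; first lra.
  rewrite -natr1 lerD2r leNgt; apply/negP => /ltW /min; by rewrite ltnn.
move=> m; apply/idP/idP => [/min//|Mm].
by apply: le_trans hM _; rewrite ler_nat.
Qed.

Lemma nat_threshold_le (b : R) : 0 <= b -> exists M : nat,
  [/\ b < M%:R, M%:R <= b + 1 & forall m : nat, (m%:R <= b) = (m < M)%N].
Proof.
move=> b0; have ex : exists m : nat, b < m%:R by eexists; exact: truncnS_gt.
case: (ex_minnP ex) => M hM min; exists M; split => //.
  case: M hM min => [|M] hM min; first lra.
  rewrite -natr1 lerD2r leNgt; apply/negP => /min; by rewrite ltnn.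
move=> m; rewrite leNgt ltnNge; congr (~~ _); apply/idP/idP => [/min//|Mm].
by apply: lt_le_trans hM _; rewrite ler_nat.
Qed.

Lemma decomp_prob_bounds n M1 M2 : (0 < n)%N -> (M1 <= M2)%N ->
  1 - (excess R M2 n / t n + tree_sum (cutoff M1 D) n / t n) <=
  decomp_prob R n [set x | (M1 <= max_forest x < M2)%N] <= 1.
Proof.
move=> n0 M12; rewrite decomp_prob_range //.
have tn0 : 0 < t n by case: n n0 => // n _; exact: tser_gt0.
have v2 := tree_sum_cutoff_le R M2 n.
have v1 : 0 <= tree_sum (cutoff M1 D) n by apply: tree_sum_ge0; exact: cutoff_ge0.
rewrite ler_pdivrMr // mul1r; apply/andP; split; last lra.
by rewrite -mulrDl ler_pdivlMr // mulrBl divfK ?gt_eqF // mul1r /excess; lra.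
Qed.

(** With [x = ln n], [w = x^(1 - s)] and [beta = - ln q], the threshold is [L = x / beta], and
    moving it by [eps L] changes [n q^M] by a factor [exp w] either way. Half of this exponent
    absorbs the losses at size [M]. *)
Lemma prob_estimate (s : R) : 0 < s -> s < 1 -> exists X0 K : R, forall n : nat,
  X0 <= ln n%:R ->
  1 - K / ln n%:R `^ (1 - s) <= decomp_prob R n
     [set x | (1 - ln (n%:R : R) `^ (- s))
                  * (- 2%:R * ln n%:R / ln (polya_radius R))
                <= (max_forest x)%:R
                <= (1 + ln (n%:R : R) `^ (- s))
                  * (- 2%:R * ln n%:R / ln (polya_radius R))] <= 1.
Proof.
move=> s0 s1; have q0 := @sqrt_radius_gt0 R; have q1 := @sqrt_radius_lt1 R.
have [beta betaE] : exists beta : R, beta = - ln q by eexists.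
have beta0 : 0 < beta by rewrite betaE oppr_gt0 ln_lt0 // q0.
have lnrho : ln rho = - (2 * beta).
  by rewrite -sqrt_radius_sq lnXn // betaE; ring.
have qexp m : q ^+ m = expR (- (beta * m%:R)).
  by rewrite betaE mulNr opprK expRM_natr lnK.
have [A [A0 hA]] := tser_lower R.
have [C1 [C10 upper]] := upper_tail A0 hA.
have [c3 [c30 lower]] := lower_tail A0 hA.
have s1' : 0 < 1 - s by lra.
have [is0 is1] : 0 < (1 - s)^-1 /\ (1 - s) * (1 - s)^-1 = 1.
  by rewrite invr_gt0 mulfV // gt_eqF.
move: ((1 - s)^-1) is0 is1 => is_ is0 is1.
have ib0 : 0 < beta^-1 by rewrite invr_gt0.
(* All cutoffs in play are at most [2 L + 3 x = cc x], as [x >= 1]; then [ln x = ln w / (1 - s)]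
   bounds [1 + ln m] by [a (1 + ln w)]. *)
have [cc ccE] : exists cc : R, cc = 2 * beta^-1 + 3 by eexists.
have cc1 : 1 <= cc by lra.
have lcc : 0 <= ln cc by exact: ln_ge0.
have [a aE] : exists a : R, a = 1 + ln cc + is_ by eexists.
have a0 : 0 <= a by lra.
have A2a : 0 <= 2 * A * a ^+ 2 by rewrite mulr_ge0 ?mulr_ge0 ?sqr_ge0.
have half0 : 0 < 1 / 2 :> R by lra.
have quarter0 : 0 < 1 / 4 :> R by lra.
have [C2 [C20 hC2]] := log_sq_le A2a half0.
have is20 : 0 <= 2 * is_ by lra.
have [C5 [C50 hC5]] := log_sq_le is20 quarter0.
have [c4 c4E] : exists c4 : R, c4 = c3 * expR (- (3 * beta) - C2) by eexists.
have c40 : 0 < c4 by rewrite c4E mulr_gt0 ?expR_gt0.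
have [c5 c5E] : exists c5 : R, c5 = 4 * A * expR C5 by eexists.
(* Completes the square in [c5 z - c4 z^2 <= C6 - z], where [z = exp (w / 4)]. *)
have [C6 C6E] : exists C6 : R, C6 = (c5 + 1) ^+ 2 / (4 * c4) by eexists.
exists (Num.max 1 beta), (C1 * expR C2 * 2 + expR C6 * 4).
(* The bound [x >= 1] serves the comparisons of powers of [x], and [x >= beta] gives [L >= 1]. *)
move=> n; rewrite ge_max => /andP[].
set x := ln (n%:R : R) => x1 xb; have x0 : 0 < x by lra.
have n0 : (0 < n)%N.
  by rewrite lt0n; apply/negP => /eqP n0; move: x1; rewrite /x n0 ln0 // ler10.
have nx : n%:R = expR x by rewrite /x lnK // posrE ltr0n.
set eps := x `^ (- s); set w := x `^ (1 - s).
have w1 : 1 <= w by rewrite -[leLHS](powRr0 x) ler_powR // ltW.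
have w0 : 0 < w by lra.
have eps0 : 0 <= eps by exact: powR_ge0.
have eps1 : eps <= 1 by rewrite -[leRHS](powRr0 x) ler_powR // oppr_le0 ltW.
have epsw : eps * x = w.
  rewrite /w addrC powRD; last by apply/implyP => _; rewrite gt_eqF.
  by rewrite powRr1 // ltW.
have wx : w <= x by rewrite -epsw ler_piMl // ltW.
have lw0 : 0 <= ln w by exact: ln_ge0.
have lx : ln x = is_ * ln w by rewrite /w ln_powR mulrA (mulrC is_) is1 mul1r.
have [L LE] : exists L : R, L = x * beta^-1 by eexists.
have -> : - 2%:R * x / ln rho = L.
  by rewrite lnrho LE; field; rewrite gt_eqF.
have Lb : beta * L = x by rewrite LE mulrCA mulfV ?mulr1 // gt_eqF.
have L0 : 0 < L by rewrite LE mulr_gt0.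
have L1 : 1 <= L by rewrite -(ler_pM2l beta0) Lb mulr1.
have a10 : 0 <= (1 - eps) * L by rewrite mulr_ge0 ?subr_ge0 // ltW.
have a20 : 0 <= (1 + eps) * L by rewrite mulr_ge0 ?(ltW L0) //; lra.
have eL : 0 <= eps * L by rewrite mulr_ge0 // ltW.
have eL1 : eps * L <= L by rewrite ler_piMl // ltW.
have beL : beta * (eps * L) = w by rewrite mulrCA Lb.
have [M1 [M1hi hM1]] := nat_threshold_ge a10.
have [M2 [M2lo M2hi hM2]] := nat_threshold_le a20.
have -> : [set x0 | (1 - eps) * L <= (max_forest x0)%:R <= (1 + eps) * L] =
    [set x0 | (M1 <= max_forest x0 < M2)%N].
  by apply/seteqP; split => y /=; rewrite hM1 hM2.
have M12 : (M1 <= M2)%N by rewrite -hM1; apply: ltW; lra.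
have /andP[lo ->] := decomp_prob_bounds n0 M12; rewrite andbT; apply: le_trans lo.
rewrite lerD2l lerN2.
have logM m : (0 < m)%N -> m%:R <= cc * x ->
    2 * A * (1 + ln m%:R) ^+ 2 <= 1 / 2 * w + C2.
  move=> m0 hm; apply: le_trans (hC2 _ w1).
  have mR : 1 <= m%:R :> R by rewrite ler1n.
  have lm0 := ln_ge0 mR.
  have h : 1 + ln m%:R <= a * (1 + ln w).
    have : ln m%:R <= ln (cc * x) by rewrite ler_ln ?posrE ?mulr_gt0 ?ltr0n //; clear -cc1; lra.
    rewrite lnM ?posrE //; last lra.
    rewrite lx aE => h.
    have : 0 <= (1 + ln cc) * ln w by rewrite mulr_ge0 //; clear -lcc; lra.
    by clear -h lm0 lw0 is0 lcc; lra.
  rewrite -[leRHS]mulrA -exprMn; apply: ler_wpM2l; first by rewrite mulr_ge0.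
  by rewrite ler_sqr ?nnegrE //; clear -h lm0 a0 lw0; lra.
have ccx : cc * x = 2 * L + 3 * x by rewrite ccE LE; ring.
have M2pos : (1 < M2)%N.
  by rewrite -hM2; lra.
have U : excess R M2 n / t n <= C1 * expR C2 * 2 / w.
  apply: le_trans (upper M2 n M2pos n0) _.
  rewrite -!mulrA; apply: ler_wpM2l => //.
  have hl : 2 * A * (1 + ln M2%:R) ^+ 2 <= 1 / 2 * w + C2.
    by apply: logM; [exact: ltnW|lra].
  have hb : beta * ((1 + eps) * L) <= beta * M2%:R by rewrite ler_pM2l // ltW.
  rewrite mulrDl mul1r mulrDr Lb beL in hb.
  apply: (@le_trans _ _ (expR C2 * expR (- (w / 2)))).
    by rewrite nx qexp -!expRD ler_expR; lra.
  apply: ler_wpM2l; first exact: expR_ge0.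
  rewrite expRN -[leRHS]invrK invf_div lef_pV2 ?posrE ?expR_gt0 ?divr_gt0 //.
  by have := expR_ge1Dx (w / 2); clear; lra.
have V : tree_sum (cutoff M1 D) n / t n <= expR C6 * 4 / w.
  have [h h0 /andP[hMl hMu]] : exists2 h, (0 < h)%N & (M1 <= h.*2 <= M1 + 2)%N.
    clear; exists (M1./2).+1 => //.
    by have := odd_double_half M1; rewrite doubleS; case: (odd M1) => /=; lia.
  have tn0 : 0 < t n by case: (n) n0 => // n' _; exact: tser_gt0.
  apply: (@le_trans _ _ (tree_sum (cutoff h.*2 D) n / t n)).
    rewrite ler_wpM2r ?invr_ge0 ?(ltW tn0) //; exact: tree_sum_cutoff_mono.
  apply: le_trans (lower h n h0 n0) _.
  (* Rounding the lower threshold up costs at most [1] and making it even at most [2]: this is the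
     [3] in [c4]. *)
  have MR : h.*2%:R <= (1 - eps) * L + 3.
    by have : h.*2%:R <= (M1 + 2)%:R :> R by [rewrite ler_nat]; rewrite natrD; lra.
  have hR : h%:R <= h.*2%:R :> R by rewrite ler_nat -addnn leq_addr.
  have hl : 2 * A * (1 + ln h%:R) ^+ 2 <= 1 / 2 * w + C2 by apply: logM => //; clear -hR MR ccx eL L1 x1; lra.
  have hl0 : 0 <= A * (1 + ln h%:R) ^+ 2 by rewrite mulr_ge0 ?sqr_ge0.
  pose z := expR (w / 4); have z0 : 0 < z by exact: expR_gt0.
  have zz : z ^+ 2 = expR (w / 2) by rewrite expr2 -expRD; congr expR; clear; lra.
  have e1 : expR (- (3 * beta) - C2) * z ^+ 2 <=
      n%:R * (q ^+ h.*2 * expR (- (A * (1 + ln h%:R) ^+ 2))).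
    have hb : beta * h.*2%:R <= beta * ((1 - eps) * L + 3) by rewrite ler_pM2l.
    rewrite mulrDr mulrBl mul1r mulrBr Lb beL in hb.
    by rewrite zz nx qexp -!expRD ler_expR; clear -hb hl hl0; lra.
  (* The loss at size [n] is a power of [w] up to a constant, hence at most a multiple of [z], while
     the main exponent is of order [z^2]. *)
  have e2 : A * (1 + x) ^+ 2 <= c5 * z.
    have hx : (1 + x) ^+ 2 <= 4 * x ^+ 2.
      apply: (@le_trans _ _ ((2 * x) ^+ 2)).
        by rewrite ler_sqr ?nnegrE; clear -x1; lra.
      by rewrite exprMn; clear; lra.
    have x2 : x ^+ 2 = expR (2 * is_ * ln w).
      by rewrite -mulrA -lx mulr_natl mulr2n expRD lnK ?expr2 // posrE.
    have hx2 : x ^+ 2 <= expR C5 * z.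
      rewrite x2 -expRD ler_expR; apply: (@le_trans _ _ (2 * is_ * (1 + ln w) ^+ 2)).
        apply: ler_wpM2l => //; have := sqr_ge0 (ln w); rewrite !expr2; clear -lw0; lra.
      by have := hC5 _ w1; clear; lra.
    apply: le_trans (ler_wpM2l A0 hx) _.
    by have := ler_wpM2l A0 hx2; rewrite c5E; clear; lra.
  have e3 : c4 * z ^+ 2 <= c3 * (n%:R * (q ^+ h.*2 * expR (- (A * (1 + ln h%:R) ^+ 2)))).
    by rewrite c4E -mulrA ler_wpM2l // ltW.
  have e4 : c5 * z - c4 * z ^+ 2 <= C6 - z.
    rewrite -subr_ge0 C6E.
    have -> : (c5 + 1) ^+ 2 / (4 * c4) - z - (c5 * z - c4 * z ^+ 2) =
      (2 * c4 * z - (c5 + 1)) ^+ 2 / (4 * c4) by clear -c40; field; rewrite gt_eqF.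
    by apply: divr_ge0; [exact: sqr_ge0|rewrite mulr_ge0 // ltW].
  apply: (@le_trans _ _ (expR (C6 - z))); first by rewrite ler_expR -/x; clear -e2 e3 e4; lra.
  rewrite expRD -!mulrA; apply: ler_wpM2l; first exact: expR_ge0.
  rewrite expRN -[leRHS]invrK invf_div lef_pV2 ?posrE ?expR_gt0 ?divr_gt0 //.
  have ez := expR_ge1Dx z; have ew : 1 + w / 4 <= z by exact: expR_ge1Dx.
  by clear -ez ew; lra.
by apply: le_trans (lerD U V) _; rewrite -mulrDl.
Qed.

End Concentration.

Theorem theorem1 (R : realType) (s : R) (hs0 : 0 < s) (hs1 : s < 1) :
  (fun n : nat => decomp_prob R n
     [set x | (1 - ln (n%:R : R) `^ (- s))
                  * (- 2%:R * ln n%:R / ln (polya_radius R))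
                <= (max_forest x)%:R
                <= (1 + ln (n%:R : R) `^ (- s))
                  * (- 2%:R * ln n%:R / ln (polya_radius R))])
  @ \oo --> (1 : R).
Proof.
have [X0 [K hK]] := prob_estimate hs0 hs1.
apply/cvgrPdist_le => e e0.
have s1 : 0 < 1 - s by lra.
(* Once [(ln n)^(1 - s) >= W] the error [K / (ln n)^(1 - s)] is at most [e]; the [+ 1] keeps [W]
   positive when [K = 0]. *)
pose W := `|K| / e + 1.
have W0 : 0 < W by rewrite ltr_wpDl // divr_ge0 // ltW.
pose X := Num.max X0 (W `^ ((1 - s)^-1)).
near=> n.
have Xn : X <= ln (n%:R : R).
  have h : expR X <= n%:R by near: n; exact: nbhs_infty_ger.
  have n0 := lt_le_trans (expR_gt0 X) h.
  by rewrite -[leLHS]expRK ler_ln ?posrE ?expR_gt0.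
have /andP[Xn0 XW] : (X0 <= ln (n%:R : R)) && (W `^ ((1 - s)^-1) <= ln (n%:R : R)).
  by rewrite -ge_max.
have /andP[lo hi] := hK n Xn0.
have Ww : W <= ln (n%:R : R) `^ (1 - s).
  have -> : W = (W `^ ((1 - s)^-1)) `^ (1 - s).
    by rewrite -powRrM mulVf ?gt_eqF // powRr1 // ltW.
  apply: ge0_ler_powR; rewrite ?nnegrE ?powR_ge0 ?(ltW s1) //.
  exact: le_trans (powR_ge0 _ _) XW.
rewrite ger0_norm ?subr_ge0 // lerBlDr -lerBlDl; apply: le_trans lo.
rewrite lerD2l lerN2; set w := _ `^ (1 - s) in Ww *.
have w0 : 0 < w by exact: lt_le_trans Ww.
rewrite ler_pdivrMr // (le_trans (ler_norm K)) //.
have h : `|K| <= e * W by rewrite mulrDr mulr1 mulrCA mulfV ?gt_eqF // mulr1 lerDl ltW.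
by apply: le_trans h _; rewrite ler_wpM2l // ltW.
Unshelve. all: by end_near.
Qed.
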